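(* Let $k$ be an algebraically closed field and let $A$ and $B$ be complete Noetherian local rings containing $k$ such that $A\hat{\otimes}_k B$ is Noetherian. If $A$ and $B$ are domains, then $A\hat{\otimes}_k B$ is a domain.
   Context: With $\mathfrak{m}$, $\mathfrak{n}$ the maximal ideals of $A$, $B$, $A\hat{\otimes}_k B=\varprojlim_{i,j}\,(A/\mathfrak{m}^i)\otimes_k(B/\mathfrak{n}^j)$. *)

(* Defs.v *)
From HB Require Import structures.
From mathcomp Require Import all_boot all_order all_algebra.
Set Implicit Arguments. Unset Strict Implicit. Unset Printing Implicit Defensive.
Import GRing.Theory.
Local Open Scope ring_scope.

Section RingDefs.
Variable R : comNzRingType.

Definition is_ideal (I : R -> Prop) : Prop :=
  [/\ I 0, (forall x y, I x -> I y -> I (x + y)) & (forall r x, I x -> I (r * x))].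

Fixpoint ideal_pow (I : R -> Prop) (n : nat) : R -> Prop :=
  match n with
  | 0 => fun _ => True
  | n'.+1 => fun x => exists s : seq (R * R),
      (forall p, p \in s -> I p.1 /\ ideal_pow I n' p.2) /\
      x = \sum_(p <- s) p.1 * p.2
  end.

Definition is_noetherian : Prop :=
  forall I : nat -> R -> Prop, (forall n, is_ideal (I n)) ->
    (forall n x, I n x -> I n.+1 x) ->
    exists N, forall n x, (N <= n)%N -> I n x -> I N x.

Definition is_domain_ring : Prop :=
  (1 != 0 :> R) /\ forall x y : R, x * y = 0 -> x = 0 \/ y = 0.

Definition is_complete_wrt (m : R -> Prop) : Prop :=
  (forall x, (forall n, ideal_pow m n x) -> x = 0) /\
  (forall x : nat -> R, (forall n, ideal_pow m n (x n.+1 - x n)) ->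
     exists L, forall n, ideal_pow m n (L - x n)).
End RingDefs.

Section LocalDefs.
Variable R : comUnitRingType.
Definition max_ideal : R -> Prop := fun x => x \isn't a GRing.unit.
Definition is_local : Prop :=
  (1 != 0 :> R) /\ forall x y, max_ideal x -> max_ideal y -> max_ideal (x + y).
Definition is_complete_local : Prop := is_complete_wrt max_ideal.
End LocalDefs.

Section Tensor.
Variables (k : fieldType) (A B : comUnitAlgType k).

Definition kbilinear (V : lmodType k) (phi : A -> B -> V) : Prop :=
  (forall (c : k) a a' b, phi (c *: a + a') b = c *: phi a b + phi a' b) /\
  (forall (c : k) a b b', phi a (c *: b + b') = c *: phi a b + phi a b').

(* A formal sum s = sum_p p.1 (x) p.2 (s : seq (A * B)) represents an element
   of (A/I) (x)_k (B/J).  Two formal sums represent the same element iff every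
   k-bilinear map A/I x B/J -> V (i.e. k-bilinear A x B -> V vanishing on
   I x B and A x J), into every k-vector space V, takes the same value on them
   (universal property of the tensor product). *)
Definition tens_eq (I : A -> Prop) (J : B -> Prop) (s t : seq (A * B)) : Prop :=
  forall (V : lmodType k) (phi : A -> B -> V), kbilinear phi ->
    (forall a b, I a -> phi a b = 0) -> (forall a b, J b -> phi a b = 0) ->
    \sum_(p <- s) phi p.1 p.2 = \sum_(p <- t) phi p.1 p.2.

(* Elements of A (^x)_k B = lim_{i,j} (A/m^i) (x)_k (B/n^j): families of
   representatives indexed by (i,j), compatible under the transition maps. *)
Definition cfam := nat -> nat -> seq (A * B).

Definition tij (i j : nat) := tens_eq (ideal_pow (@max_ideal A) i) (ideal_pow (@max_ideal B) j).

Definition ctens_elt (x : cfam) : Prop :=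
  forall i j, tij i j (x i.+1 j) (x i j) /\ tij i j (x i j.+1) (x i j).

Definition ctens_eq (x y : cfam) : Prop := forall i j, tij i j (x i j) (y i j).

Definition ctens0 : cfam := fun _ _ => [::].
Definition ctens1 : cfam := fun _ _ => [:: (1, 1)].
Definition ctens_add (x y : cfam) : cfam := fun i j => x i j ++ y i j.
Definition ctens_mul (x y : cfam) : cfam :=
  fun i j => [seq (p.1 * q.1, p.2 * q.2) | p <- x i j, q <- y i j].

Definition ctens_ideal (I : cfam -> Prop) : Prop :=
  [/\ forall x, I x -> ctens_elt x,
      I ctens0,
      forall x y, I x -> I y -> I (ctens_add x y),
      forall r x, ctens_elt r -> I x -> I (ctens_mul r x) &
      forall x y, ctens_elt y -> ctens_eq x y -> I x -> I y].

Definition ctens_noetherian : Prop :=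
  forall I : nat -> cfam -> Prop, (forall n, ctens_ideal (I n)) ->
    (forall n x, I n x -> I n.+1 x) ->
    exists N, forall n x, (N <= n)%N -> I n x -> I N x.

Definition ctens_domain : Prop :=
  ~ ctens_eq ctens1 ctens0 /\
  forall x y, ctens_elt x -> ctens_elt y ->
    ctens_eq (ctens_mul x y) ctens0 -> ctens_eq x ctens0 \/ ctens_eq y ctens0.
End Tensor.

(* Main.v *)
(** A nonzero element [X] of [A ^(x) B] is detected by a continuous linear form
    [g] on [B], which sends it to an element [g(X)] of [A]. Given nonzero [X] and
    [Y], let [a] be the product of two such nonzero values. By Artin-Rees
    [a x \in m^l] implies [x \in m^(l - c)], so [a] is not integral over [m^N] for
    [N = c + 1]; hence some valuation ring [O] of a field containing [A] dominates
    [A] and has [v(a) < v(m^N)]. Dividing [X] and [Y] by values [g(X)], [g'(Y)] of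
    minimal valuation yields nonzero leading forms in [kappa ^(x) B], where [kappa]
    is the residue field of [O], and the leading form of [X Y] is their product.
    Applying this to both factors reduces the claim to [kappa (x) kappa'] for
    fields containing [k]; there finitely many elements of [kappa] can be
    specialised to [k], keeping a given one nonzero, because [k] is algebraically
    closed. *)
Require Import Defs.
From HB Require Import structures.
From mathcomp Require Import all_boot all_order all_algebra.
From mathcomp Require Import boolp classical_sets.
From mathcomp Require Import ring zify.
Set Implicit Arguments. Unset Strict Implicit. Unset Printing Implicit Defensive.
Import GRing.Theory.
Local Open Scope ring_scope.

(** * Linear forms *)

(** The ideal generated by the values of [X] need not be principal, so [A] itself offers no value to
    divide by; in a valuation ring, a value of least valuation divides all the others. The element
    [a] has to beat [m^N] because [X] is truncated modulo [m^N]: the error, divided by [a], then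
    falls into the maximal ideal, so one row of the family determines the leading form. Completeness
    makes the values, which are limits, elements of [A]. No value group, residue field or tensor
    product is formed: a valuation ring is a pair of predicates on a field, its residue field is
    that same pair, and, [k] being a field, an element of a tensor product is zero as soon as all
    products of linear forms on the two factors kill it. The valuation is built by enlarging only
    the future maximal ideal; its ring is recovered as the ring of multipliers. *)

Lemma zorn_above (T : Type) (P : set T -> Prop) (X0 : set T) :
  P X0 ->
  (forall F : set (set T), F X0 -> (forall X, F X -> P X) -> total_on F subset ->
     P (\bigcup_(X in F) X)%classic) ->
  exists M, P M /\ forall Y, (M `<=` Y)%classic -> P Y -> (Y `<=` M)%classic.
Proof.
move=> P0 Pchain.
pose Q (X : set T) := X = set0 \/ P X /\ (X0 `<=` X)%classic.
have [F FQ Ftot|M [QM Mmax]] := @Zorn_bigcup T Q.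
  have [[X [FX PX]]|noX] := pselect (exists X, F X /\ (P X /\ (X0 `<=` X)%classic)).
    right; split; last by move=> t /PX.2 Xt; exists X.
    pose F' X := X = X0 \/ F X /\ (P X /\ (X0 `<=` X)%classic).
    have -> : (\bigcup_(X in F) X)%classic = (\bigcup_(X in F') X)%classic.
      apply/seteqP; split=> t [Y FY Yt].
        have [Y0|[PY XY]] := FQ _ FY; first by rewrite Y0 in Yt.
        by exists Y => //; right.
      case: FY => [Y0|[FY _]]; last by exists Y.
      by exists X => //; apply: PX.2; rewrite -Y0.
    apply: Pchain; first by left.
      by move=> Y [->|[_ []]].
    move=> Y Z [->|[FY [_ XY]]] [->|[FZ [_ XZ]]]; [by left|by left|by right|exact: Ftot].
  left; apply/seteqP; split=> // t [Y FY Yt].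
  have [Y0|PY] := FQ _ FY; first by rewrite Y0 in Yt.
  by case: noX; exists Y.
have {}QM : P M /\ (X0 `<=` M)%classic.
  case: QM => // M0; suff X00 : X0 = set0 by rewrite M0; split; [rewrite -X00|rewrite X00].
  apply: contrapT => X0n; apply: (Mmax X0); last by right; split.
  by rewrite M0; split=> // sub; apply: X0n; apply/seteqP; split.
exists M; split; first by case: QM.
move=> Y MY PY; apply: contrapT => nYM; apply: (Mmax Y) => //.
by right; split=> //; apply: subset_trans MY; case: QM.
Qed.

Section LinearForms.
Variables (k : fieldType) (R : comNzRingType) (io : {rmorphism k -> R}).

Definition subspace (W : R -> Prop) :=
  [/\ W 0, forall x y, W x -> W y -> W (x + y) & forall c x, W x -> W (io c * x)].

Definition linear_form (f : R -> k) :=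
  (forall x y, f (x + y) = f x + f y) /\ (forall c x, f (io c * x) = c * f x).

Definition vanishes_on (W : R -> Prop) (f : R -> k) := forall x, W x -> f x = 0.

Lemma subspaceN W : subspace W -> forall x, W x -> W (- x).
Proof. by case=> _ _ WZ x /(WZ (-1)); rewrite rmorphN1 mulN1r. Qed.

Lemma subspaceB W : subspace W -> forall x y, W x -> W y -> W (x - y).
Proof. by move=> sW x y Wx Wy; have [_ WD _] := sW; apply: WD => //; apply: subspaceN. Qed.

Lemma subspace_sum W : subspace W -> forall (I : eqType) (s : seq I) F,
  (forall i, i \in s -> W (F i)) -> W (\sum_(i <- s) F i).
Proof.
case=> W0 WD _ I s F WF; rewrite big_seq_cond; apply: (big_ind W) => // i.
by rewrite andbT; apply: WF.
Qed.

Lemma linear_form0 f : linear_form f -> f 0 = 0.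
Proof. by case=> _ /(_ 0 0); rewrite mulr0 mul0r. Qed.

Lemma linear_formN f : linear_form f -> forall x, f (- x) = - f x.
Proof. by case=> _ fZ x; rewrite -[- x]mulN1r -(rmorphN1 io) fZ mulN1r. Qed.

Lemma linear_formB f : linear_form f -> forall x y, f (x - y) = f x - f y.
Proof. by move=> lf x y; rewrite lf.1 linear_formN. Qed.

Lemma linear_form_sum f : linear_form f -> forall I (s : seq I) P F,
  f (\sum_(i <- s | P i) F i) = \sum_(i <- s | P i) f (F i).
Proof. by move=> lf I s P F; apply: big_morph; [apply: lf.1|apply: linear_form0]. Qed.

(** A subspace maximal among those containing [W] and avoiding [b] is a hyperplane complementary to
    the line of [b]; [f] is the coordinate along that line. *)
Lemma separating_form W b : subspace W -> ~ W b ->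
  exists f, [/\ linear_form f, vanishes_on W f & f b = 1].
Proof.
move=> sW nWb.
pose P (X : set R) := [/\ subspace X, (W `<=` X)%classic & ~ X b].
have [|F FW FP Ftot|M [[sM WM nMb] Mmax]] := @zorn_above R P W.
- by split.
- split=> [|x Wx|[X FX Xb]]; [split| |].
  + by exists W => //; case: sW.
  + move=> x y [X FX Xx] [Y FY Yy].
    have [/(_ _ Xx) Yx|/(_ _ Yy) Xy] := Ftot _ _ FX FY.
      by exists Y => //; have [[_ YD _] _ _] := FP _ FY; apply: YD.
    by exists X => //; have [[_ XD _] _ _] := FP _ FX; apply: XD.
  + by move=> c x [X FX Xx]; exists X => //; have [[_ _ XZ] _ _] := FP _ FX; apply: XZ.
  + by exists W.
  + by have [] := FP _ FX.
have [M0 MD MZ] := sM.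
have decomp z : exists c, M (z - io c * b).
  have [Mz|nMz] := pselect (M z); first by exists 0; rewrite rmorph0 mul0r subr0.
  pose Y x := exists c, M (x - io c * z).
  have MY : (M `<=` Y)%classic by move=> x Mx; exists 0; rewrite rmorph0 mul0r subr0.
  have sY : subspace Y.
    split; first exact: MY.
      move=> x y [c Mx] [d My]; exists (c + d); rewrite rmorphD.
      by have := MD _ _ Mx My; congr M; ring.
    move=> c x [d Mx]; exists (c * d); rewrite rmorphM.
    by have := MZ c _ Mx; congr M; ring.
  have [[c Mb]|nYb] := pselect (Y b).
    have c0 : c != 0.
      by apply/eqP => c0; apply: nMb; move: Mb; rewrite c0 rmorph0 mul0r subr0.
    exists c^-1; have := subspaceN sM (MZ c^-1 _ Mb); congr M.
    by rewrite mulrBr mulrA -rmorphM mulVf // rmorph1; ring.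
  case: nMz; apply: (Mmax Y) => //.
    by split=> //; apply: subset_trans MY.
  by exists 1; rewrite rmorph1 mul1r subrr.
have [f fP] := choice decomp.
have uniq z c : M (z - io c * b) -> f z = c.
  move=> Mc; apply/eqP; rewrite -subr_eq0; apply/negP => /negP d0; apply: nMb.
  have := MZ (f z - c)^-1 _ (subspaceB sM Mc (fP z)).
  have -> : z - io c * b - (z - io (f z) * b) = io (f z - c) * b by rewrite rmorphB; ring.
  by rewrite mulrA -rmorphM mulVf // rmorph1 mul1r.
exists f; split; [split| |].
- move=> x y; apply: uniq; rewrite rmorphD.
  by have := MD _ _ (fP x) (fP y); congr M; ring.
- by move=> c x; apply: uniq; rewrite rmorphM; have := MZ c _ (fP x); congr M; ring.
- by move=> x Wx; apply: uniq; rewrite rmorph0 mul0r subr0; apply: WM.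
- by apply: uniq; rewrite rmorph1 mul1r subrr.
Qed.

Lemma not_subspaceP W b : subspace W ->
  (forall f, linear_form f -> vanishes_on W f -> f b = 0) -> W b.
Proof.
move=> sW H; apply: contrapT => nWb; have [f [lf fW fb]] := separating_form sW nWb.
by have := H _ lf fW; rewrite fb => /eqP; rewrite oner_eq0.
Qed.

(** Elimination modulo [W]: a vector outside [W] plus the span of the earlier ones gets a form
    vanishing there, and what the earlier coordinates leave of it becomes the new [e l]. The clause
    over all subspaces [O] says that each [e l] lies in the span of [s]. *)
Lemma dual_family W (s : seq R) : subspace W ->
  exists n (f : nat -> R -> k) (e : nat -> R),
  [/\ forall l, linear_form (f l) /\ vanishes_on W (f l),
      forall (O : R -> Prop), subspace O -> (forall b, b \in s -> O b) -> forall l, O (e l) &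
      forall b, b \in s -> W (b - \sum_(l < n) io (f l b) * e l)].
Proof.
move=> sW; have [W0 WD WZ] := sW; elim: s => [|b s [n [f [e [fP eP sP]]]]].
  exists 0%N, (fun _ _ => 0), (fun _ => 0); split=> //.
  - by move=> l; split=> //; split=> *; rewrite ?addr0 ?mulr0.
  - by move=> O [O0 _ _].
have [[c Wc]|nc] := pselect (exists c : nat -> k,
    W (b - \sum_(i < size s) io (c i) * s`_i)).
  exists n, f, e; split=> //.
    by move=> O sO sub; apply: eP => // x xs; apply: sub; rewrite inE xs orbT.
  move=> x; rewrite inE => /orP[/eqP->|]; last exact: sP.
  set u := \sum_(i < size s) _ in Wc.
  have fu l : f l b = f l u.
    by apply/eqP; rewrite -subr_eq0 -(linear_formB (fP l).1) (fP l).2.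
  have -> : b - \sum_(l < n) io (f l b) * e l =
     (b - u) + \sum_(i < size s) io (c i) * (s`_i - \sum_(l < n) io (f l s`_i) * e l).
    under [X in _ = _ + X]eq_bigr do rewrite mulrBr.
    rewrite sumrB -/u subrKA; congr (_ - _).
    under [RHS]eq_bigr do rewrite mulr_sumr.
    rewrite exchange_big /=; apply: eq_bigr => l _.
    rewrite fu (linear_form_sum (fP l).1) rmorph_sum mulr_suml.
    by apply: eq_bigr => i _; rewrite (fP l).1.2 rmorphM mulrA.
  apply: WD => //; apply: subspace_sum => // i _; apply: WZ; apply: sP.
  by rewrite mem_nth.
pose V x := exists c : nat -> k, W (x - \sum_(i < size s) io (c i) * s`_i).
have WV x : W x -> V x.
  move=> Wx; exists (fun => 0); rewrite big1 ?subr0 // => i _.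
  by rewrite rmorph0 mul0r.
have sV : subspace V.
  split; first exact: WV.
    move=> x y [c Wx] [d Wy]; exists (fun i => c i + d i).
    have := WD _ _ Wx Wy; congr W; rewrite addrACA -opprD -big_split; congr (_ - _).
    by apply: eq_bigr => i _; rewrite rmorphD mulrDl.
  move=> d x [c Wx]; exists (fun i => d * c i).
  have := WZ d _ Wx; congr W; rewrite mulrBr mulr_sumr; congr (_ - _).
  by apply: eq_bigr => i _; rewrite rmorphM mulrA.
have Vs x : x \in s -> V x.
  move=> xs; exists (fun i => (i == index x s)%:R); rewrite -index_mem in xs.
  rewrite (bigD1 (Ordinal xs)) //= big1 ?addr0.
    by rewrite eqxx rmorph1 mul1r nth_index -?index_mem // subrr.
  by move=> i /negPf; rewrite -val_eqE /= => ->; rewrite rmorph0 mul0r.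
have [g [lg gV gb]] := separating_form sV nc.
exists n.+1, (fun l => if l == n then g else f l),
  (fun l => if l == n then b - \sum_(l < n) io (f l b) * e l else e l).
have red x : \sum_(l < n.+1) io ((if (l : nat) == n then g else f l) x) *
      (if (l : nat) == n then b - \sum_(l < n) io (f l b) * e l else e l) =
   \sum_(l < n) io (f l x) * e l + io (g x) * (b - \sum_(l < n) io (f l b) * e l).
  rewrite big_ord_recr /= eqxx; congr (_ + _); apply: eq_bigr => l _.
  by rewrite ltn_eqF.
split.
- by move=> l; case: eqP => // _; split=> // x /WV; apply: gV.
- move=> O sO sub; have Oe l : O (e l).
    by apply: eP => // x xs; apply: sub; rewrite inE xs orbT.
  move=> l; case: eqP => // _; apply: subspaceB => //.
    by apply: sub; rewrite mem_head.
  by have [_ _ OZ] := sO; apply: subspace_sum => // i _; apply: OZ.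
- move=> x; rewrite inE => /orP[/eqP->|xs]; rewrite red.
    by rewrite gb rmorph1 mul1r subrKC subrr.
  by rewrite gV ?rmorph0 ?mul0r ?addr0; [apply: sP|apply: Vs].
Qed.

End LinearForms.

(** * Formal sums and completed tensor products *)

Section FormalSums.
Variables (k : fieldType) (R S : comNzRingType).
Variables (ioR : {rmorphism k -> R}) (ioS : {rmorphism k -> S}).

Definition pairing (f : R -> k) (g : S -> k) (s : seq (R * S)) : k :=
  \sum_(p <- s) f p.1 * g p.2.

(** The image of [s] under $\mathrm{id} \otimes g$. *)
Definition contraction (g : S -> k) (s : seq (R * S)) : R :=
  \sum_(p <- s) ioR (g p.2) * p.1.

Definition smul (s t : seq (R * S)) : seq (R * S) :=
  [seq (p.1 * q.1, p.2 * q.2) | p <- s, q <- t].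

(** These are the additive maps out of $R \otimes_k S$; the target carries no scalars, so
    contractions into rings and forms into [k] are treated alike. *)
Definition balanced (V : zmodType) (g : R -> S -> V) :=
  [/\ forall a a' b, g (a + a') b = g a b + g a' b,
      forall a b b', g a (b + b') = g a b + g a b' &
      forall c a b, g (ioR c * a) b = g a (ioS c * b)].

Lemma big_smul (V : zmodType) (g : R -> S -> V) s t :
  \sum_(p <- smul s t) g p.1 p.2 =
  \sum_(p <- s) \sum_(q <- t) g (p.1 * q.1) (p.2 * q.2).
Proof. by rewrite big_allpairs_dep. Qed.

Lemma pairing_contraction f g s : linear_form ioR f ->
  pairing f g s = f (contraction g s).
Proof.
move=> lf; rewrite (linear_form_sum lf); apply: eq_bigr => p _.
by rewrite lf.2 mulrC.
Qed.

Lemma balanced_sumr (V : zmodType) (g : R -> S -> V) : balanced g ->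
  forall a n (F : nat -> S), g a (\sum_(l < n) F l) = \sum_(l < n) g a (F l).
Proof.
case=> _ gD _ a n F; apply: (big_morph (g a) (gD a)).
by apply: (addrI (g a 0)); rewrite -gD !addr0.
Qed.

Lemma balanced_suml (V : zmodType) (g : R -> S -> V) : balanced g ->
  forall b (s : seq (R * S)) F, g (\sum_(p <- s) F p) b = \sum_(p <- s) g (F p) b.
Proof.
case=> gD _ _ b s F; have g0 : g 0 b = 0 by apply: (addrI (g 0 b)); rewrite -gD !addr0.
by apply: (big_morph (g ^~ b) _ g0) => x y; apply: gD.
Qed.

(* Rewriting [s] along a dual family of its second components: the first
   components become contractions of [s], the class of [s] is unchanged. *)
Lemma normal_form (J : S -> Prop) (s : seq (R * S)) : subspace ioS J ->
  exists t : seq (R * S),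
  [/\ forall p, p \in t -> exists g, [/\ linear_form ioS g, vanishes_on J g &
                                         p.1 = contraction g s],
      forall O : S -> Prop, subspace ioS O -> (forall p, p \in s -> O p.2) ->
        forall p, p \in t -> O p.2 &
      forall (V : zmodType) (g : R -> S -> V), balanced g ->
        (forall a b, J b -> g a b = 0) ->
        \sum_(p <- s) g p.1 p.2 = \sum_(p <- t) g p.1 p.2].
Proof.
move=> sJ; have [n [f [e [fP eP sP]]]] := dual_family [seq p.2 | p <- s] sJ.
exists [seq (contraction (f l) s, e l) | l <- iota 0 n]; split.
- by move=> p /mapP[l _ ->]; exists (f l); have [? ?] := fP l.
- move=> O sO Os p /mapP[l _ ->]; apply: eP => // b /mapP[q qs ->]; exact: Os.
- move=> V g bg gJ; rewrite big_map.
  have -> : \sum_(l <- iota 0 n) g (contraction (f l) s) (e l) =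
            \sum_(l < n) g (contraction (f l) s) (e l).
    by rewrite -[n in iota 0 n]subn0 big_mkord.
  under [RHS]eq_bigr do rewrite /contraction (balanced_suml bg).
  rewrite exchange_big /= big_seq [RHS]big_seq; apply: eq_bigr => p ps.
  have [gDl gDr gZ] := bg.
  under eq_bigr do rewrite gZ.
  rewrite -(balanced_sumr bg _ n (fun l => ioS (f l p.2) * e l)).
  rewrite -[X in g _ X](subrK (\sum_(l < n) ioS (f l p.2) * e l)) gDr gJ ?add0r //.
  by apply: sP; apply: map_f.
Qed.

(** Products are well defined, replacing one factor at a time. As [J] is stable only under
    multiplication by [O], the factor held fixed needs second components in [O]: this is [s'] during
    the first replacement and [t] during the second. *)
Lemma big_smul_congr (J : S -> Prop) (O : S -> Prop) (g : R -> S -> k) s s' t t' :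
  balanced g -> (forall a b, J b -> g a b = 0) ->
  (forall r x, O r -> J x -> J (r * x)) ->
  (forall p, p \in t -> O p.2) -> (forall p, p \in s' -> O p.2) ->
  (forall h : R -> S -> k, balanced h -> (forall a b, J b -> h a b = 0) ->
     \sum_(p <- s) h p.1 p.2 = \sum_(p <- t) h p.1 p.2) ->
  (forall h : R -> S -> k, balanced h -> (forall a b, J b -> h a b = 0) ->
     \sum_(p <- s') h p.1 p.2 = \sum_(p <- t') h p.1 p.2) ->
  \sum_(p <- smul s s') g p.1 p.2 = \sum_(p <- smul t t') g p.1 p.2.
Proof.
move=> [gDl gDr gZ] gJ JM tO s'O st s't'; rewrite !big_smul exchange_big /=.
under eq_big_seq => q qs'.
  rewrite (st (fun a b => g (a * q.1) (b * q.2))); first over.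
    split=> [a a' b|a b b'|c a b]; rewrite ?mulrDl //.
    by rewrite -mulrA gZ mulrA.
  by move=> a b Jb; apply: gJ; rewrite mulrC; apply: JM => //; apply: s'O.
rewrite exchange_big /=; apply: eq_big_seq => p pt.
apply: (s't' (fun a b => g (p.1 * a) (p.2 * b))).
  split=> [a a' b|a b b'|c a b]; rewrite ?mulrDr //.
  by rewrite mulrCA gZ mulrCA.
by move=> a b Jb; apply: gJ; apply: JM => //; apply: tO.
Qed.

Lemma balanced_pairing f g : linear_form ioR f -> linear_form ioS g ->
  balanced (fun a b => f a * g b : k).
Proof.
move=> lf lg; split=> [a a' b|a b b'|c a b]; first by rewrite lf.1 mulrDl.
  by rewrite lg.1 mulrDr.
by rewrite lf.2 lg.2 mulrCA mulrA.
Qed.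

End FormalSums.

(* The associated object is the quotient [ord / fil i]; linear forms are taken on
   the whole carrier, so that restricting to [ord] loses nothing. *)
Record filtered (k : fieldType) := Filtered {
  carrier :> comNzRingType;
  emb : {rmorphism k -> carrier};
  ord : carrier -> Prop;
  fil : nat -> carrier -> Prop;
  ord_emb : forall c, ord (emb c);
  ordD : forall x y, ord x -> ord y -> ord (x + y);
  ordM : forall x y, ord x -> ord y -> ord (x * y);
  fil0 : forall i, fil i 0;
  filD : forall i x y, fil i x -> fil i y -> fil i (x + y);
  filM : forall i r x, ord r -> fil i x -> fil i (r * x);
  filS : forall i x, fil i.+1 x -> fil i x }.

Arguments emb {k} f.
Arguments ord {k} f _.
Arguments fil {k} f _ _.

(** * Completed tensor products of filtered algebras, tested by linear forms *)

Section CompletedTensor.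
Variable k : fieldType.

Lemma subspace_ord (F : filtered k) : subspace (emb F) (ord F).
Proof.
split; [by rewrite -(rmorph0 (emb F)); apply: ord_emb|exact: ordD|].
by move=> c x; apply: ordM; apply: ord_emb.
Qed.

Lemma subspace_fil (F : filtered k) i : subspace (emb F) (fil F i).
Proof. by split; [apply: fil0|apply: filD|move=> c x; apply: filM; apply: ord_emb]. Qed.

Lemma fil_le (F : filtered k) i j x : (i <= j)%N -> fil F j x -> fil F i x.
Proof.
by move=> /subnK <-; elim: (j - i)%N => // d IH; rewrite addSn => /filS.
Qed.

Definition form (F : filtered k) i (f : F -> k) :=
  linear_form (emb F) f /\ vanishes_on (fil F i) f.

Lemma form_le (F : filtered k) i j f : (i <= j)%N -> @form F i f -> @form F j f.
Proof. by move=> ij [lf f0]; split=> // x /(fil_le ij)/f0. Qed.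

Definition null (F G : filtered k) i j (s : seq (F * G)) :=
  forall f g, @form F i f -> @form G j g -> pairing f g s = 0.

Definition family (F G : filtered k) (x : nat -> nat -> seq (F * G)) :=
  (forall i j p, p \in x i j -> ord F p.1 /\ ord G p.2) /\
  (forall i j f g, @form F i f -> @form G j g ->
     pairing f g (x i.+1 j) = pairing f g (x i j) /\
     pairing f g (x i j.+1) = pairing f g (x i j)).

Definition tensor_domain (F G : filtered k) :=
  forall x y, @family F G x -> @family F G y ->
    (forall i j, null i j (smul (x i j) (y i j))) ->
    (forall i j, null i j (x i j)) \/ (forall i j, null i j (y i j)).

Definition swap (F G : Type) (s : seq (F * G)) : seq (G * F) :=
  [seq (p.2, p.1) | p <- s].

Lemma pairing_swap (F G : filtered k) (f : F -> k) (g : G -> k) (s : seq (F * G)) :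
  pairing g f (swap s) = pairing f g s.
Proof. by rewrite /pairing big_map; apply: eq_bigr => p _; rewrite mulrC. Qed.

Lemma null_swap (F G : filtered k) i j (s : seq (F * G)) :
  null i j s <-> null j i (swap s).
Proof.
split=> sn f g fP gP; first by rewrite pairing_swap; apply: sn.
by rewrite -pairing_swap; apply: sn.
Qed.

Lemma smul_swap (F G : comNzRingType) (s t : seq (F * G)) :
  smul (swap s) (swap t) = swap (smul s t).
Proof.
rewrite /smul /swap map_allpairs allpairs_mapl /=.
elim: s => //= p s ->; congr (_ ++ _); rewrite -map_comp; exact: eq_map.
Qed.

Lemma family_swap (F G : filtered k) x : @family F G x ->
  @family G F (fun i j => swap (x j i)).
Proof.
case=> xO xc; split=> [i j p /mapP[q qx ->]|i j f g fP gP] /=.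
  by have [] := xO _ _ _ qx.
by rewrite !pairing_swap; have [] := xc j i g f gP fP.
Qed.

Lemma tensor_domain_swap (F G : filtered k) : tensor_domain F G -> tensor_domain G F.
Proof.
move=> FG x y /family_swap fx /family_swap fy xy0.
have [|x0|y0] := FG _ _ fx fy; [|left=> i j|right=> i j].
- by move=> i j; rewrite smul_swap -null_swap; apply: xy0.
- by rewrite null_swap; apply: x0.
- by rewrite null_swap; apply: y0.
Qed.

End CompletedTensor.

(** * Extension of valuations *)

(** [O] is a valuation ring of [E] and [M] its maximal ideal: if [x] in [O] is outside [M], its
    inverse is in [O], since otherwise [val_inv] for that inverse would put [x] in [M]. *)
Record valuation_pair (E : fieldType) (O M : E -> Prop) : Prop := ValuationPair {
  val1 : O 1;
  valD : forall x y, O x -> O y -> O (x + y);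
  valM : forall x y, O x -> O y -> O (x * y);
  val_max0 : M 0;
  val_maxD : forall x y, M x -> M y -> M (x + y);
  val_maxM : forall x y, O x -> M y -> M (x * y);
  val_max_sub : forall x, M x -> O x;
  val_max1 : ~ M 1;
  val_max_prime : forall x y, O x -> O y -> M (x * y) -> M x \/ M y;
  val_inv : forall x, ~ O x -> M x^-1 }.

Section ValuationExtension.
Variables (E : fieldType) (S M0 : E -> Prop).
Hypotheses (S0 : S 0) (SN1 : S (-1)).

Record nonunital_ideal (M : E -> Prop) : Prop := NonunitalIdeal {
  nuD : forall x y, M x -> M y -> M (x + y);
  nuM : forall x y, M x -> M y -> M (x * y);
  nuZ : forall x y, S x -> M y -> M (x * y);
  nu0 : M 0;
  nu1 : ~ M 1 }.

Section Maximal.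
Variable M : E -> Prop.
Hypothesis nuM_ : nonunital_ideal M.
Hypothesis maxM : forall M', nonunital_ideal M' -> (forall x, M x -> M' x) ->
  forall x, M' x -> M x.

Let O z := forall x, M x -> M (z * x).

Let M_neg x : M x -> M (- x).
Proof. by move=> Mx; rewrite -mulN1r; apply: nuZ. Qed.

Let M_sum I (s : seq I) (P : pred I) F : (forall i, P i -> M (F i)) -> M (\sum_(i <- s | P i) F i).
Proof. by move=> MF; apply: (big_ind M) => //; [apply: nu0|apply: nuD]. Qed.

(** The set $M[z]$ of polynomial expressions with all coefficients in [M], the constant one
    included. *)
Let adjoined z x := exists P : {poly E}, (forall i, M P`_i) /\ x = P.[z].

Let adjoined_nu z : ~ adjoined z 1 -> nonunital_ideal (adjoined z).
Proof.
move=> n1; split=> //.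
- move=> x y [P [MP ->]] [Q [MQ ->]]; exists (P + Q); split; last by rewrite hornerD.
  by move=> i; rewrite coefD; apply: nuD.
- move=> x y [P [MP ->]] [Q [MQ ->]]; exists (P * Q); split; last by rewrite hornerM.
  by move=> i; rewrite coefM; apply: M_sum => j _; apply: nuM.
- move=> x y Sx [P [MP ->]]; exists (x *: P); split; last by rewrite hornerZ.
  by move=> i; rewrite coefZ; apply: nuZ.
- by exists 0; split; [move=> i; rewrite coef0; apply: nu0|rewrite horner0].
Qed.

(** If $1 \notin M[z]$, maximality gives $M[z] = M$, which contains $zM$. *)
Let O_of_adjoined z : ~ adjoined z 1 -> O z.
Proof.
move=> n1 x Mx; apply: (maxM (adjoined_nu n1)).
  move=> y My; exists y%:P; split; last by rewrite hornerC.
  by move=> i; rewrite coefC; case: eqP => // _; apply: nu0.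
exists (x *: 'X); split; last by rewrite hornerZ hornerX mulrC.
move=> i; rewrite coefZ coefX; case: eqP => _; rewrite ?mulr1 ?mulr0 //.
exact: nu0.
Qed.

(* If [1 = P(z) = Q(1/z)] with [deg Q <= deg P], the leading term of [P] can be
   eliminated; this needs no inverse of [1 - Q(0)]. *)
Let adjoined_both n m z (P Q : {poly E}) : z != 0 -> (size P <= n.+1)%N ->
  (size Q <= m.+1)%N -> (forall i, M P`_i) -> (forall i, M Q`_i) ->
  P.[z] = 1 -> Q.[z^-1] = 1 -> False.
Proof.
have [N] := ubnP (n + m)%N; elim: N => // N IH in n m z P Q *.
wlog mn : n m z P Q / (m <= n)%N.
  move=> W nm z0 sP sQ MP MQ Pz Qz; case/orP: (leq_total m n) => le.
    exact: (W n m z P Q).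
  by apply: (W m n z^-1 Q P); rewrite ?invr_eq0 ?invrK // addnC.
move=> nm z0 sP sQ MP MQ Pz Qz; case: n => [|n] in nm mn sP *.
  by apply: (nu1 nuM_); rewrite -Pz (size1_polyC sP) hornerC.
(* [P'] expands $1 = q + (1-q)(1-t) + t(1-q)$ for $q = Q_0$ and $t = P_{n+1} z^{n+1}$: here $1-t$ is
   the lower part of $P(z)$, and $1-q$ is the tail of $Q(1/z)$, of degree at most $n+1$ in $1/z$, so
   no negative power of [z] survives. *)
pose P' := \poly_(i < n.+1)
  (Q`_0 *+ (i == 0%N) + (P`_i - Q`_0 * P`_i) + P`_n.+1 * Q`_(n.+1 - i)).
apply: (IH n m z P' Q) => //; first by apply: size_poly.
  move=> i; rewrite coef_poly; case: ifP => _; last exact: nu0.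
  apply: nuD => //; last exact: nuM.
  apply: nuD => //; last by apply: nuD => //; apply: M_neg; apply: nuM.
  by rewrite mulrb; case: eqP => _; [apply: MQ|apply: nu0 nuM_].
rewrite horner_poly; under eq_bigr do rewrite 2!mulrDl.
rewrite !big_split /= big_ord_recl /= expr0 mulr1 mulr1n big1 ?addr0; last first.
  by move=> i _; rewrite mulr0n mul0r.
have eP : \sum_(i < n.+1) (P`_i - Q`_0 * P`_i) * z ^+ i =
          (1 - Q`_0) * (1 - P`_n.+1 * z ^+ n.+1).
  rewrite -[X in _ * (X - _)]Pz (horner_coef_wide _ sP) [in RHS]big_ord_recr /= addrK mulr_sumr.
  by apply: eq_bigr => i _; rewrite mulrA; congr (_ * _); rewrite mulrBl mul1r.
have eQ : \sum_(i < n.+1) P`_n.+1 * Q`_(n.+1 - i) * z ^+ i =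
          P`_n.+1 * (z ^+ n.+1 * (1 - Q`_0)).
  rewrite -Qz (horner_coef_wide _ (leq_trans sQ (_ : m.+1 <= n.+2)%N)) //.
  rewrite [in RHS]big_ord_recl /= expr0 mulr1 [X in X - _]addrC addrK !mulr_sumr.
  rewrite (reindex_inj rev_ord_inj) /=; apply: eq_bigr => i _.
  rewrite -mulrA; congr (_ * _); rewrite /bump /= add1n.
  have -> : (n.+1 - (n.+1 - i.+1) = i.+1)%N by have := ltn_ord i; lia.
  rewrite mulrCA; congr (_ * _); rewrite exprVn.
  apply: (mulIf (expf_neq0 i.+1 z0)); rewrite mulfVK ?expf_neq0 // -exprD.
  by congr (_ ^+ _); have := ltn_ord i; lia.
rewrite eP eQ; ring.
Qed.

(** Maximality is tested on two enlargements: $M[z]$ yields the dichotomy between [z] and its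
    inverse, and $M + Ot$ shows that [M] is radical in [O]. Together they make every element of [O]
    outside [M] a unit of [O]. *)
Lemma maximal_valuation_pair : valuation_pair O M.
Proof.
have MO x : M x -> O x by move=> Mx y My; apply: nuM.
have O1 : O 1 by move=> x; rewrite mul1r.
have OD x y : O x -> O y -> O (x + y).
  by move=> Ox Oy z Mz; rewrite mulrDl; apply: nuD => //; [apply: Ox|apply: Oy].
have OM x y : O x -> O y -> O (x * y).
  by move=> Ox Oy z Mz; rewrite -mulrA; apply: Ox; apply: Oy.
have OZ x y : O x -> M y -> M (x * y) by move=> Ox; apply: Ox.
have dicho z : ~ O z -> O z^-1.
  move=> nOz; have z0 : z != 0.
    apply/eqP => z0; apply: nOz => x _; rewrite z0 mul0r; exact: nu0.
  apply: O_of_adjoined => -[Q [MQ Qz]]; apply: nOz; apply: O_of_adjoined => -[P [MP Pz]].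
  by apply: (@adjoined_both (size P) (size Q) z P Q) => //; apply: leqnSn.
have SO x : S x -> O x by move=> Sx y; apply: nuZ.
have sq t : O t -> M (t * t) -> M t.
  move=> Ot Mtt; apply: contrapT => nMt.
  (* $M + Ot$ is closed under products because $t^2 \in M$. *)
  pose M' x := exists u y, [/\ M u, O y & x = u + y * t].
  apply: (nMt); apply: (maxM (M' := M')); first split.
  - move=> _ _ [u [y [Mu Oy ->]]] [v [w [Mv Ow ->]]]; exists (u + v), (y + w).
    by split; [apply: nuD|apply: OD|ring].
  - move=> _ _ [u [y [Mu Oy ->]]] [v [w [Mv Ow ->]]].
    exists (u * v + y * w * (t * t)), (u * w + y * v).
    split; [apply: nuD => //|by apply: OD; apply: OM => //; apply: MO|ring].
      exact: nuM.
    by apply: OZ => //; apply: OM.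
  - move=> x _ Sx [u [y [Mu Oy ->]]]; exists (x * u), (x * y).
    by split; [apply: nuZ|apply: OM => //; apply: SO|ring].
  - by exists 0, 0; split; [apply: nu0|apply: SO|ring].
  - (* [1 = u + y t] gives [t = t u + y t^2]. *)
    move=> [u [y [Mu Oy e1]]]; apply: nMt.
    have -> : t = t * u + y * (t * t) by rewrite -[LHS]mulr1 e1; ring.
    by apply: nuD => //; apply: OZ.
  - by move=> x Mx; exists x, 0; split=> //; [apply: SO|ring].
  - by exists 0, 1; split=> //; [apply: nu0|ring].
have pow s n : O s -> M (s ^+ n) -> M s.
  move=> Os Msn; have {Msn} : M (s ^+ (2 ^ n)).
    rewrite -(subnK (ltnW (ltn_expl n (isT : 1 < 2)%N))) exprD.
    by apply: OZ => //; elim: (2 ^ n - n)%N => [|d IH]; rewrite ?expr0 // exprS; apply: OM.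
  elim: n => [|n IH]; first by rewrite expn0 expr1.
  rewrite expnS mulnC exprM expr2 => /sq Ms; apply: IH; apply: Ms.
  by elim: (2 ^ n)%N => [|d IH]; rewrite ?expr0 // exprS; apply: OM.
have inv s : O s -> ~ M s -> O s^-1.
  move=> Os nMs; have s0 : s != 0 by apply/eqP => s0; apply: nMs; rewrite s0; apply: nu0.
  (* If $1 \in M[1/s]$, clearing denominators puts a power of [s] into [M], hence [s] itself by
     radicality. *)
  apply: O_of_adjoined => -[P [MP Ps]]; apply: nMs; apply: (pow _ (size P) Os).
  have -> : s ^+ size P = \sum_(i < size P) P`_i * s ^+ (size P - i).
    rewrite -[LHS]mulr1 Ps horner_coef mulr_sumr; apply: eq_bigr => i _.
    rewrite mulrCA; congr (_ * _); rewrite exprVn.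
    apply: (mulIf (expf_neq0 i s0)); rewrite mulfVK ?expf_neq0 // -exprD subnK //.
    exact: ltnW.
  apply: M_sum => i _; rewrite mulrC; apply: OZ => //.
  by elim: (size P - i)%N => [|d IH]; rewrite ?expr0 // exprS; apply: OM.
split=> //; [exact: nu0|exact: nuD|exact: nu1| |].
  move=> x y Ox Oy Mxy; have [|nMx] := pselect (M x); [by left|right].
  have x0 : x != 0 by apply/eqP => x0; apply: nMx; rewrite x0; apply: nu0.
  by rewrite -[y](mulKf x0); apply: OZ => //; apply: inv.
move=> z nOz; have Oz := dicho _ nOz; apply: contrapT => nMz; apply: nOz.
by rewrite -[z]invrK; apply: inv.
Qed.

End Maximal.

Lemma valuation_extension : nonunital_ideal M0 ->
  exists O M, [/\ valuation_pair O M, forall x, S x -> O x & forall x, M0 x -> M x].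
Proof.
move=> nu0_; pose P (M : set E) := nonunital_ideal M /\ (forall x, M0 x -> M x).
have [|F FM0 FP Ftot|M [[nuM_ M0M] Mmax]] := @zorn_above E P M0; first by split.
  split; last by move=> x M0x; exists M0.
  have dir x y : (\bigcup_(X in F) X)%classic x -> (\bigcup_(X in F) X)%classic y ->
      exists X, [/\ F X, X x & X y].
    move=> [X FX Xx] [Y FY Yy]; have [/(_ _ Xx) Yx|/(_ _ Yy) Xy] := Ftot _ _ FX FY.
      by exists Y.
    by exists X.
  split.
  - move=> x y Fx Fy; have [X [FX Xx Xy]] := dir _ _ Fx Fy.
    by exists X => //; have [nuX _] := FP _ FX; apply: nuD.
  - move=> x y Fx Fy; have [X [FX Xx Xy]] := dir _ _ Fx Fy.
    by exists X => //; have [nuX _] := FP _ FX; apply: nuM.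
  - by move=> x y Sx [X FX Xy]; exists X => //; have [nuX _] := FP _ FX; apply: nuZ.
  - by exists M0 => //; apply: nu0.
  - by move=> [X FX X1]; have [nuX _] := FP _ FX; apply: nu1 X1.
exists (fun z => forall x, M x -> M (z * x)), M; split=> //.
  apply: maximal_valuation_pair => // M' nuM' MM'; apply: Mmax => //.
  by split=> // x /M0M /MM'.
by move=> x Sx y; apply: nuZ.
Qed.

End ValuationExtension.

(** * Hilbert basis theorem and Artin-Rees *)

Section Ideals.
Variable R : comNzRingType.
Implicit Types I J K : R -> Prop.

Definition ideal_prod I J x := exists s : seq (R * R),
  (forall p, p \in s -> I p.1 /\ J p.2) /\ x = \sum_(p <- s) p.1 * p.2.

Lemma ideal_sum I (T : eqType) (s : seq T) F : is_ideal I ->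
  (forall i, i \in s -> I (F i)) -> I (\sum_(i <- s) F i).
Proof.
case=> I0 ID _ IF; rewrite big_seq_cond; apply: (big_ind I) => // i.
by rewrite andbT; apply: IF.
Qed.

Lemma idealN I : is_ideal I -> forall x, I x -> I (- x).
Proof. by case=> _ _ IM x Ix; rewrite -mulN1r; apply: IM. Qed.

Lemma idealB I : is_ideal I -> forall x y, I x -> I y -> I (x - y).
Proof. by move=> iI x y Ix Iy; have [_ ID _] := iI; apply: ID => //; apply: idealN. Qed.

Lemma ideal_prod_ideal I J : is_ideal I -> is_ideal (ideal_prod I J).
Proof.
move=> [_ _ IM]; split.
- by exists [::]; rewrite big_nil.
- move=> x y [s [sP ->]] [t [tP ->]]; exists (s ++ t); rewrite big_cat; split=> // p.
  by rewrite mem_cat => /orP[/sP|/tP].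
- move=> r x [s [sP ->]]; exists [seq (r * p.1, p.2) | p <- s]; split.
    by move=> p /mapP[q /sP[Iq Jq] ->]; split=> //; apply: IM.
  by rewrite big_map mulr_sumr; apply: eq_bigr => p _; rewrite mulrA.
Qed.

Lemma ideal_prod_mul I J x y : I x -> J y -> ideal_prod I J (x * y).
Proof.
move=> Ix Jy; exists [:: (x, y)]; rewrite big_seq1; split=> // p.
by rewrite inE => /eqP ->.
Qed.

Lemma ideal_prod_min I J K : is_ideal K -> (forall x y, I x -> J y -> K (x * y)) ->
  forall x, ideal_prod I J x -> K x.
Proof. by move=> iK IJ _ [s [sP ->]]; apply: ideal_sum => // p /sP[/IJ]; apply. Qed.

Lemma ideal_comap K y : is_ideal K -> is_ideal (fun x => K (x * y)).
Proof.
case=> K0 KD KM; split=> [|x z Kx Kz|r x Kx]; first by rewrite mul0r.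
  by rewrite mulrDl; apply: KD.
by rewrite -mulrA; apply: KM.
Qed.

Lemma ideal_pow_ideal I n : is_ideal I -> is_ideal (ideal_pow I n).
Proof. by move=> iI; case: n => [|n]; [split|apply: ideal_prod_ideal]. Qed.

Lemma ideal_powM I a b x y : is_ideal I ->
  ideal_pow I a x -> ideal_pow I b y -> ideal_pow I (a + b) (x * y).
Proof.
move=> iI; elim: a x => [|a IH] x Ix Iy.
  by have [_ _ IM] := ideal_pow_ideal b iI; apply: IM.
have := ideal_pow_ideal (a.+1 + b) iI => /(ideal_comap y) iK.
apply: (ideal_prod_min iK _ Ix) => u v Iu Iv; rewrite -mulrA.
by apply: ideal_prod_mul => //; apply: IH.
Qed.

Lemma ideal_powS I n x : is_ideal I -> ideal_pow I n.+1 x -> ideal_pow I n x.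
Proof.
move=> iI; have iK := ideal_pow_ideal n iI; have [_ _ IM] := iK.
by apply: ideal_prod_min => // u v _; apply: IM.
Qed.

Lemma ideal_pow_le I a b x : is_ideal I -> (a <= b)%N ->
  ideal_pow I b x -> ideal_pow I a x.
Proof.
move=> iI /subnK <-; elim: (b - a)%N => // d IH; rewrite addSn => /(ideal_powS iI).
exact: IH.
Qed.

Lemma ideal_pow1 I x : is_ideal I -> ideal_pow I 1 x <-> I x.
Proof.
move=> iI; split=> [|Ix]; last by rewrite -[x]mulr1; apply: (@ideal_prod_mul I (ideal_pow I 0)).
have [_ _ IM] := iI; apply: (@ideal_prod_min I (ideal_pow I 0)) => // u v Iu _.
by rewrite mulrC; apply: IM.
Qed.

Lemma ideal_pow_iter I N n x : is_ideal I ->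
  ideal_pow (ideal_pow I N) n x -> ideal_pow I (n * N) x.
Proof.
move=> iI; elim: n x => [|n IH] x //.
apply: ideal_prod_min; first exact: ideal_pow_ideal.
by move=> u v Iu Iv; rewrite mulSn; apply: ideal_powM => //; apply: IH.
Qed.

Lemma noetherian_maximal (T : Type) (F : T -> R -> Prop) (t0 : T) :
  is_noetherian R -> (forall t, is_ideal (F t)) ->
  exists t, forall t', (forall x, F t x -> F t' x) -> forall x, F t' x -> F t x.
Proof.
move=> noeth iF; apply: contrapT => nmax.
have step t : exists t', (forall x, F t x -> F t' x) /\ ~ (forall x, F t' x -> F t x).
  apply: contrapT => nt; apply: nmax; exists t => t' tt'; apply: contrapT => n'.
  by apply: nt; exists t'.
have [f fP] := choice step.
have [|n x|N stab] := noeth (fun n => F (iter n f t0)) _ _.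
- by move=> n; apply: iF.
- by apply: (fP _).1.
- by apply: (fP (iter N f t0)).2 => x Fx; apply: (stab N.+1).
Qed.

Definition span (xs : seq R) y := forall K, is_ideal K -> (forall x, x \in xs -> K x) -> K y.

Lemma noetherian_span I : is_noetherian R -> is_ideal I ->
  exists xs : seq R, (forall x, x \in xs -> I x) /\ (forall y, I y -> span xs y).
Proof.
move=> noeth iI; pose T := {xs : seq R | forall x, x \in xs -> I x}.
have nilI : forall x, x \in [::] -> I x by [].
have [|[xs xsI] xsmax] := @noetherian_maximal T (fun t => span (sval t)) (exist _ [::] nilI) noeth.
  move=> [xs _] /=; split=> [K [] //|x y sx sy K iK Ks|r x sx K iK Ks].
    by have [_ KD _] := iK; apply: KD; [apply: sx|apply: sy].
  by have [_ _ KM] := iK; apply: KM; apply: sx.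
exists xs; split=> // y Iy.
have yxsI : forall x, x \in y :: xs -> I x.
  by move=> x; rewrite inE => /orP[/eqP->|/xsI].
apply: (xsmax (exist _ (y :: xs) yxsI)) => /=.
  by move=> x sx K iK Ks; apply: sx => // z zs; apply: Ks; rewrite inE zs orbT.
by move=> K _; apply; rewrite mem_head.
Qed.

End Ideals.

(** The ideals [L n d] of degree-[d] leading coefficients grow in both indices. Stationarity of the
    diagonal settles all degrees from [N0] on; each of the finitely many columns below [N0] is
    stationary on its own. Past the largest bound, leading terms are cancelled by induction on the
    size. *)
Lemma noetherian_poly (R : comNzRingType) : is_noetherian R -> is_noetherian {poly R}.
Proof.
move=> noeth J iJ Jinc.
have Jle n n' P : (n <= n')%N -> J n P -> J n' P.
  by move=> /subnK <-; elim: (n' - n)%N => // d IH /IH; rewrite addSn; apply: Jinc.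
pose L n d c := exists P, [/\ J n P, (size P <= d.+1)%N & P`_d = c].
have iL n d : is_ideal (L n d).
  have [J0 JD JM] := iJ n; split.
  - by exists 0; rewrite size_poly0 coef0.
  - move=> x y [P [JP sP <-]] [Q [JQ sQ <-]]; exists (P + Q); rewrite coefD; split=> //.
      exact: JD.
    by rewrite (leq_trans (size_polyD _ _)) // geq_max sP.
  - move=> r x [P [JP sP <-]]; exists (r%:P * P); split; first exact: JM.
      by rewrite mul_polyC (leq_trans (size_scale_leq _ _)).
    by rewrite mul_polyC coefZ.
have Lshift n d e P : J n P -> (size P <= d.+1)%N -> J n ('X^e * P) /\
    (size ('X^e * P)%R <= (e + d).+1)%N /\ ('X^e * P)`_(e + d) = P`_d.
  move=> JP sP; have [_ _ JM] := iJ n; split; first exact: JM.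
  rewrite coefXnM ltnNge leq_addr /= addKn; split=> //.
  by rewrite (leq_trans (size_polyMleq _ _)) // size_polyXn addSn /= -addnS leq_add2l.
have Lle n n' d d' c : (n <= n')%N -> (d <= d')%N -> L n d c -> L n' d' c.
  move=> nn' dd' [P [JP sP <-]]; have [JX [sX cX]] := Lshift n d (d' - d)%N P JP sP.
  rewrite subnK // in sX cX; exists ('X^(d' - d) * P); split=> //.
  exact: Jle JX.
have [|n x|N0 stab0] := noeth (fun n => L n n); [by move=> n|exact: Lle|].
have [Nd NdP] : exists Nd : nat -> nat, forall d n x, (Nd d <= n)%N -> L n d x -> L (Nd d) d x.
  have /choice[f fP] d : exists N, forall n x, (N <= n)%N -> L n d x -> L N d x.
    by apply: (noeth (fun n => L n d)) => // n x; apply: Lle.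
  by exists f.
pose N := maxn N0 (\max_(d < N0) Nd d).
exists N => n P Nn; have [s] := ubnP (size P); elim: s => // s IH in P *.
rewrite ltnS leq_eqVlt => /orP[/eqP sP|]; last exact: IH.
case: s => [|d] in IH sP *.
  by move/eqP: sP; rewrite size_poly_eq0 => /eqP -> _; have [] := iJ N.
move=> JP; have LP : L n d P`_d by exists P; rewrite sP.
have [Q [JQ sQ cQ]] : L N d P`_d.
  case: (leqP N0 d) => [N0d|dN0].
    apply: (Lle N0 _ N0) => //; first exact: leq_maxl.
    apply: (stab0 (maxn n d)); first by rewrite leq_max N0d orbT.
    by apply: Lle LP; rewrite ?leq_maxl ?leq_maxr.
  have NdN : (Nd d <= N)%N.
    by rewrite leq_max (leq_bigmax (Ordinal dN0)) orbT.
  by apply: (Lle (Nd d) _ d) => //; apply: NdP LP; apply: leq_trans Nn.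
rewrite -[P](subrK Q); have [_ JD _] := iJ N; apply: (JD) => //; apply: IH.
  rewrite ltnS; apply/leq_sizeP => i; rewrite leq_eqVlt => /orP[/eqP <-|di].
    by rewrite coefB cQ subrr.
  by rewrite coefB [P`_i]nth_default ?sP // nth_default ?subrr // (leq_trans sQ).
by apply: (idealB (iJ n)) => //; apply: Jle JQ.
Qed.

(** * The Rees algebra and the Artin-Rees lemma *)

Section ReesRing.
Variables (A : comNzRingType) (m : A -> Prop).
Hypotheses (noethA : is_noetherian A) (ideal_m : is_ideal m).

(** The Rees algebra $\bigoplus_i m^i X^i$, as a predicate on $A[X]$. *)
Definition rees (P : {poly A}) := forall i, ideal_pow m i P`_i.

Lemma rees0 : rees 0.
Proof. by move=> i; rewrite coef0; have [] := ideal_pow_ideal i ideal_m. Qed.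

Lemma reesD P Q : rees P -> rees Q -> rees (P + Q).
Proof.
move=> mP mQ i; rewrite coefD.
by have [_ ID _] := ideal_pow_ideal i ideal_m; apply: ID.
Qed.

Lemma reesM P Q : rees P -> rees Q -> rees (P * Q).
Proof.
move=> mP mQ i; rewrite coefM; apply: ideal_sum; first exact: ideal_pow_ideal.
move=> j _; rewrite -{1}(subnKC (leq_ord j)); exact: ideal_powM.
Qed.

(** Each [x] costs one more polynomial variable, sent to $xX$. Chains of ideals are studied in the
    polynomial ring [D], Noetherian by Hilbert's theorem, rather than in its image. *)
Lemma rees_presentation (xs : seq A) : (forall x, x \in xs -> m x) ->
  exists (D : comNzRingType) (g : {rmorphism D -> {poly A}}),
  [/\ is_noetherian D, forall d, rees (g d), forall c, exists d, g d = c%:P &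
      forall x, x \in xs -> exists d, g d = x *: 'X].
Proof.
elim: xs => [|x xs IH] xsm.
  exists A, (@polyC A); split=> //; last by move=> c; exists c.
  by move=> d [|i]; rewrite coefC //=; have [] := ideal_pow_ideal i.+1 ideal_m.
have [|D [g [noethD gR gC gX]]] := IH.
  by move=> y ys; apply: xsm; rewrite inE ys orbT.
have cfu : commr_rmorph g (x *: 'X) by move=> y; apply: mulrC.
exists {poly D}, (horner_morph cfu); split.
- exact: noetherian_poly.
- move=> P; change (rees (map_poly g P).[x *: 'X]); rewrite horner_coef; apply: (big_ind rees).
  + exact: rees0.
  + exact: reesD.
  + move=> i _; apply: reesM; first by rewrite coef_map; apply: gR.
    elim: (i : nat) => [|n IHn].
      by move=> [|j]; rewrite expr0 coefC //=; have [] := ideal_pow_ideal j.+1 ideal_m.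
    rewrite exprS; apply: reesM => // j; rewrite coefZ coefX.
    case: j => [|[|j]] //=; rewrite ?mulr1 ?mulr0.
      by apply/ideal_pow1 => //; apply: xsm; rewrite mem_head.
    by have [] := ideal_pow_ideal j.+2 ideal_m.
- by move=> c; have [d dc] := gC c; exists d%:P; rewrite [LHS]horner_morphC.
- move=> y; rewrite inE => /orP[/eqP->|/gX[d dy]]; last by exists d%:P; rewrite [LHS]horner_morphC.
  by exists 'X; rewrite [LHS]horner_morphX.
Qed.

Lemma rees_noetherian : exists (D : comNzRingType) (g : {rmorphism D -> {poly A}}),
  [/\ is_noetherian D, forall d, rees (g d) &
      forall l y, ideal_pow m l y -> exists d, g d = y *: 'X^l].
Proof.
have [xs [xsm mxs]] := noetherian_span noethA ideal_m.
have [D [g [noethD gR gC gX]]] := rees_presentation xsm.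
exists D, g; split=> //.
pose K l y := exists d, g d = y *: 'X^l.
have iK l : is_ideal (K l).
  split.
  - by exists 0; rewrite rmorph0 scale0r.
  - by move=> x y [d dx] [e ey]; exists (d + e); rewrite rmorphD dx ey scalerDl.
  - move=> r x [d dx]; have [e er] := gC r; exists (e * d).
    by rewrite rmorphM dx er mul_polyC scalerA.
elim=> [|l IH].
  by move=> y _; have [d dy] := gC y; exists d; rewrite expr0 alg_polyC.
apply: ideal_prod_min; first exact: iK.
move=> x y mx /IH[e ey].
have [d dx] : K 1%N x by apply: (mxs _ mx) => // z /gX.
by exists (d * e); rewrite rmorphM dx ey -scalerAl -scalerAr scalerA -exprD.
Qed.

(** [I n] is the preimage in [D] of the combinations of elements $(ax)X^i$ with $ax \in m^i$ and $i
    \le n$; let the chain stop at [c]. Then $(ax)X^l$ combines generators of degree $i \le c$ with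
    coefficients in the Rees algebra. Comparing coefficients of $X^l$ and cancelling [a] writes [x]
    with coefficients in $m^{l-i} \subseteq m^{l-c}$. *)
Lemma artin_rees a : is_domain_ring A -> a != 0 ->
  exists c, forall l x, ideal_pow m l (a * x) -> ideal_pow m (l - c) x.
Proof.
move=> domA a0; have [D [g [noethD gR gS]]] := rees_noetherian.
pose I n d := exists s : seq (D * (nat * A)),
  (forall p, p \in s -> (p.2.1 <= n)%N /\ ideal_pow m p.2.1 (a * p.2.2)) /\
  g d = \sum_(p <- s) g p.1 * ((a * p.2.2) *: 'X^(p.2.1)).
have [|n d [s [sP sd]]|c stab] := noethD I.
- move=> n; split.
  + by exists [::]; rewrite big_nil rmorph0.
  + move=> x y [s [sP sx]] [t [tP ty]]; exists (s ++ t).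
    rewrite big_cat rmorphD sx ty; split=> // p.
    by rewrite mem_cat => /orP[/sP|/tP].
  + move=> r x [s [sP sx]]; exists [seq (r * p.1, p.2) | p <- s]; split.
      by move=> p /mapP[q /sP ? ->].
    rewrite rmorphM sx big_map mulr_sumr; apply: eq_bigr => p _.
    by rewrite rmorphM mulrA.
- by exists s; split=> // p /sP[pn ?]; split=> //; apply: leqW.
exists c => l x max; have [d dax] := gS _ _ max.
have : I (maxn l c) d.
  exists [:: (1, (l, x))]; rewrite big_seq1 rmorph1 mul1r; split=> // p.
  by rewrite inE => /eqP -> /=; rewrite leq_maxl.
move=> /(stab _ _ (leq_maxr _ _))[s [sP]]; rewrite dax => /(congr1 (fun P : {poly A} => P`_l)).
rewrite coefZ coefXn eqxx mulr1 coef_sum => e.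
have {e} : a * (x - \sum_(p <- s | (p.2.1 <= l)%N) (g p.1)`_(l - p.2.1) * p.2.2) = 0.
  rewrite mulrBr {1}e (bigID (fun p => (p.2.1 <= l)%N)) /= [X in _ + X - _]big1 => [|p].
    rewrite addr0 mulr_sumr -sumrB big1 // => p pl.
    by rewrite -scalerAr coefZ coefMXn ltnNge pl /=; ring.
  by rewrite -scalerAr coefZ coefMXn ltnNge => ->; rewrite mulr0.
move=> /domA.2[/eqP|/subr0_eq ->]; first by rewrite (negPf a0).
rewrite big_mkcond; apply: ideal_sum; first exact: ideal_pow_ideal.
move=> p ps; have iI := ideal_pow_ideal (l - c) ideal_m; have [I0 _ IM] := iI.
case: ifP => // pl; rewrite mulrC; apply: IM.
apply: (ideal_pow_le ideal_m _ (gR _ _)).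
by have [pc _] := sP _ ps; apply: leq_sub2l.
Qed.

End ReesRing.

(** * Valuations dominating a Noetherian local domain *)

Section DominatingValuation.
Variables (A : comNzRingType) (m : A -> Prop).
Hypotheses (noethA : is_noetherian A) (domA : is_domain_ring A).
Hypotheses (ideal_m : is_ideal m) (m1 : ~ m 1).
Variables (E : fieldType) (f : {rmorphism A -> E}).
Hypothesis f_inj : injective f.

Lemma rmorph_inj_eq0 x : (f x == 0) = (x == 0).
Proof. by rewrite -(inj_eq f_inj) rmorph0. Qed.

(** Cancelling one factor [a] costs at most [c] in the exponent, and after [n] cancellations the
    unit 1 is left, which is not in [m]. *)
Lemma exp_growth a : a != 0 ->
  exists c, (forall n l, ideal_pow m l (a ^+ n) -> (l <= c * n)%N).
Proof.
move=> a0; have [c cP] := artin_rees noethA ideal_m domA a0; exists c.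
elim=> [|n IH] l.
  rewrite expr0; case: l => // l /(ideal_pow_le ideal_m (isT : 1 <= l.+1)%N).
  by move/(ideal_pow1 _ ideal_m).
by rewrite exprS => /cP /IH; rewrite mulnS; lia.
Qed.

(** * The ideal generated by $q/a$ in $A[q/a]$ *)

Section Saturation.
Variables (a : A) (q : A -> Prop).
Hypothesis ideal_q : is_ideal q.

(** With $W = q + aA$ and $Y_r = qW^r$, one has $Y_r / a^{r+1} = (q/a)(A + q/a)^r$; the union over
    [r] is the ideal generated by $q/a$ in $A[q/a]$. *)
Let W x := exists u v, q u /\ x = u + a * v.
Let Y r := ideal_prod q (ideal_pow W r).

Let ideal_W : is_ideal W.
Proof.
have [q0 qD qM] := ideal_q; split.
- by exists 0, 0; split=> //; ring.
- move=> _ _ [u [v [qu ->]]] [u' [v' [qu' ->]]]; exists (u + u'), (v + v').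
  by split; [apply: qD|ring].
- by move=> r _ [u [v [qu ->]]]; exists (r * u), (r * v); split; [apply: qM|ring].
Qed.

Let W_q u : q u -> W u.
Proof. by move=> qu; exists u, 0; split=> //; ring. Qed.

Let W_a v : W (a * v).
Proof. by have [q0 _ _] := ideal_q; exists 0, v; split=> //; ring. Qed.

Let ideal_Y r : is_ideal (Y r). Proof. exact: ideal_prod_ideal. Qed.

Let Y_a r y : Y r y -> Y r.+1 (a * y).
Proof.
rewrite mulrC; apply: (ideal_prod_min (ideal_comap a (ideal_Y r.+1))) => u w qu Ww.
rewrite -mulrA; apply: ideal_prod_mul => //; rewrite mulrC; apply: ideal_prod_mul => //.
by rewrite -[a]mulr1; apply: W_a.
Qed.

Let Y_aX d r y : Y r y -> Y (d + r) (a ^+ d * y).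
Proof.
by elim: d => [|d IH] Yy; rewrite ?expr0 ?mul1r // exprS -mulrA addSn; apply/Y_a/IH.
Qed.

Let Y_mul r s y z : Y r y -> Y s z -> Y (r + s).+1 (y * z).
Proof.
move=> Yy Yz; apply: (ideal_prod_min (ideal_comap z (ideal_Y _)) _ Yy) => u w qu Ww.
rewrite mulrC.
apply: (ideal_prod_min (ideal_comap _ (ideal_Y (r + s).+1)) _ Yz) => u' w' qu' Ww'.
have -> : u' * w' * (u * w) = u * (u' * (w * w')) by ring.
apply: ideal_prod_mul => //; apply: ideal_prod_mul; first exact: W_q.
exact: ideal_powM.
Qed.

(** In the expansion of $(q + aA)^{s+1}$ every term other than the multiples of $a^{s+1}$ has a
    factor from [q]. *)
Let W_decomp s y : ideal_pow W s.+1 y -> exists b, Y s (y - a ^+ s.+1 * b).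
Proof.
pose K r y := exists b, Y r (y - a ^+ r.+1 * b).
have iK r : is_ideal (K r).
  have [Y0 YD YM] := ideal_Y r; split.
  - by exists 0; rewrite mulr0 subr0.
  - move=> x z [b Yb] [c Yc]; exists (b + c).
    by have := YD _ _ Yb Yc; congr Y; ring.
  - move=> t x [b Yb]; exists (t * b); have := YM t _ Yb; congr Y; ring.
elim: s y => [|s IH] y.
  move/(ideal_pow1 _ ideal_W) => [u [v [qu ->]]]; exists v.
  by rewrite expr1 addrK -[u]mulr1; apply: (@ideal_prod_mul _ q (ideal_pow W 0)).
apply: (@ideal_prod_min _ W (ideal_pow W s.+1) (K s.+1)) => // w p [u [v [qu ->]]] Wp.
have [b Yb] := IH _ Wp; exists (v * b).
have [_ YD YM] := ideal_Y s.+1.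
have -> : (u + a * v) * p - a ^+ s.+2 * (v * b) = u * p + v * (a * (p - a ^+ s.+1 * b)).
  by rewrite exprS; ring.
by apply: YD; [apply: ideal_prod_mul|apply: YM; apply: Y_a].
Qed.

(* If [a ^+ r.+1] lies in [q W^r] then [W^(r+1) = q W^r], hence
   [a ^+ (n + r)] lies in [q^n] for all [n]. *)
Let W_reduction r : Y r (a ^+ r.+1) ->
  forall n x, ideal_pow W (n + r) x -> ideal_prod (ideal_pow q n) (ideal_pow W r) x.
Proof.
move=> Yr; have [_ YD YM] := ideal_Y r.
have WY y : ideal_pow W r.+1 y -> Y r y.
  move=> /W_decomp[b Yb]; rewrite -[y](subrK (a ^+ r.+1 * b)); apply: YD => //.
  by rewrite mulrC; apply: YM.
elim=> [|n IH] x; first by move=> Wx; rewrite -[x]mul1r; apply: (@ideal_prod_mul _ (ideal_pow q 0)).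
have iK : is_ideal (ideal_prod (ideal_pow q n.+1) (ideal_pow W r)).
  by apply: ideal_prod_ideal; apply: ideal_pow_ideal.
rewrite addSn; apply: (ideal_prod_min iK) => w p Ww /IH; rewrite mulrC.
apply: (ideal_prod_min (ideal_comap w iK)) => p1 p2 qp1 Wp2.
have /WY : ideal_pow W r.+1 (w * p2) by apply: ideal_prod_mul.
have -> : p1 * p2 * w = w * p2 * p1 by ring.
apply: (ideal_prod_min (ideal_comap p1 iK)) => t1 t2 qt1 Wt2.
have -> : t1 * t2 * p1 = (t1 * p1) * t2 by ring.
by apply: ideal_prod_mul => //; apply: ideal_prod_mul.
Qed.

(** If 1 were in the ideal generated by $q/a$, then $a^{r+1} \in qW^r$ for some [r], which is an
    integral equation of [a] over [q]; by [W_reduction] all $a^{n+r}$ would lie in $q^n$. *)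
Lemma saturation_nonunital : a != 0 ->
  (forall r, exists n, ~ ideal_pow q n (a ^+ (n + r))) ->
  exists M0 : E -> Prop, nonunital_ideal (fun x => exists u, x = f u) M0 /\
    forall z, q z -> M0 (f z / f a).
Proof.
move=> a0 growth; have fa0 : f a != 0 by rewrite rmorph_inj_eq0.
exists (fun z => exists r y, Y r y /\ f a ^+ r.+1 * z = f y); split; last first.
  move=> z qz; exists 0%N, z; split; last by rewrite expr1 mulrC divfK.
  by rewrite -[z]mulr1; apply: (@ideal_prod_mul _ q (ideal_pow W 0)).
split.
- move=> x z [r [y [Yy ex]]] [s [w [Yw ez]]].
  exists (s + r)%N, (a ^+ s * y + a ^+ r * w); split.
    have [_ YD _] := ideal_Y (s + r); apply: YD; first exact: Y_aX.
    by rewrite addnC; apply: Y_aX.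
  by rewrite rmorphD !rmorphM -ex -ez !rmorphXn -addnS exprD !exprS; ring.
- move=> x z [r [y [Yy ex]]] [s [w [Yw ez]]].
  exists (r + s).+1, (y * w); split; first exact: Y_mul.
  by rewrite rmorphM -ex -ez -addSn -addnS exprD; ring.
- move=> _ x [u ->] [r [y [Yy ex]]]; exists r, (u * y); split.
    by have [_ _ YM] := ideal_Y r; apply: YM.
  by rewrite rmorphM -ex mulrCA.
- exists 0%N, 0; split; first by have [Y0 _ _] := ideal_Y 0.
  by rewrite mulr0 rmorph0.
- move=> [r [y [Yy]]]; rewrite mulr1 -rmorphXn => /f_inj ey.
  rewrite -{}ey in Yy; have [n] := growth r; apply.
  have iq := ideal_pow_ideal n ideal_q; have [_ _ qM] := iq.
  have WX l : ideal_pow W l (a ^+ l).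
    elim: l => // l IH; rewrite exprS; apply: ideal_prod_mul => //.
    by rewrite -[a]mulr1; apply: W_a.
  apply: (ideal_prod_min iq _ (W_reduction Yy (WX _))) => u w qu _.
  by rewrite mulrC; apply: qM.
Qed.

End Saturation.

Lemma dominating_valuation a : a != 0 ->
  exists N O M, [/\ valuation_pair O M, forall x, O (f x) &
                    forall z, ideal_pow m N z -> M (f z / f a)].
Proof.
move=> a0; have [c growth] := exp_growth a0.
have iq := ideal_pow_ideal c.+1 ideal_m.
have [r|M0 [nuM0 qM0]] := saturation_nonunital iq a0.
  (* For $q = m^{c+1}$, membership would give $(c+1)n \le c(n+r)$, that is $n \le cr$. *)
  exists (c * r).+1 => /(ideal_pow_iter ideal_m)/growth; lia.
have [||O [M [vOM SO M0M]]] := @valuation_extension E (fun x => exists u, x = f u) M0 _ _ nuM0.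
- by exists 0; rewrite rmorph0.
- by exists (-1); rewrite rmorphN1.
exists c.+1, O, M; split=> // [x|z /qM0/M0M //].
by apply: SO; exists x.
Qed.

(** The ideals $\{z : v(z) \ge v(b)\}$ of [A] grow as $v(b)$ decreases, so a maximal one comes from
    a [b] of least value, although [v] need not be discrete. *)
Lemma minimal_value O M (P : A -> Prop) a1 : valuation_pair O M ->
  (forall x, O (f x)) -> P a1 -> a1 != 0 ->
  exists a0, [/\ P a0, a0 != 0 & forall b, P b -> O (f b / f a0)].
Proof.
move=> vOM Of Pa1 a1n0; pose T := {b | P b /\ b != 0}.
have [|[a0 [Pa0 a0n0]] /= a0max] := noetherian_maximal
    (F := fun t : T => fun z => O (f z / f (sval t))) (exist _ a1 (conj Pa1 a1n0)) noethA.
  move=> [b [Pb bn0]] /=; split.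
  - by rewrite rmorph0 mul0r; apply: (val_max_sub vOM); apply: (val_max0 vOM).
  - by move=> x y Ox Oy; rewrite rmorphD mulrDl; apply: (valD vOM).
  - by move=> r x Ox; rewrite rmorphM -mulrA; apply: (valM vOM).
exists a0; split=> // b Pb; have [->|bn0] := eqVneq b 0.
  by rewrite rmorph0 mul0r; apply: (val_max_sub vOM); apply: (val_max0 vOM).
have fa0 : f a0 != 0 by rewrite rmorph_inj_eq0.
have fb0 : f b != 0 by rewrite rmorph_inj_eq0.
apply: contrapT => nO; have Oab : O (f a0 / f b).
  by apply: (val_max_sub vOM); have := val_inv vOM nO; rewrite invfM invrK mulrC.
apply: nO; apply: (a0max (exist _ b (conj Pb bn0))) => /= [x Ox|].
  by have := valM vOM Ox Oab; rewrite mulrA divfK.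
by rewrite divff //; apply: (val1 vOM).
Qed.

End DominatingValuation.

(** * Leading forms *)

Section AdicReduction.
Variables (k : fieldType) (A : comNzRingType) (io : {rmorphism k -> A}) (m : A -> Prop).
Hypothesis ideal_m : is_ideal m.

Definition adic : filtered k.
Proof.
apply: (@Filtered k A io (fun _ => True) (ideal_pow m)) => //.
- by move=> i; have [] := ideal_pow_ideal i ideal_m.
- by move=> i; have [] := ideal_pow_ideal i ideal_m.
- by move=> i r x _; have [_ _ IM] := ideal_pow_ideal i ideal_m; apply: IM.
- by move=> i x; apply: ideal_powS.
Defined.

Section ResidueFiltered.
Variables (E : fieldType) (f : {rmorphism A -> E}) (O M : E -> Prop).
Hypotheses (vOM : valuation_pair O M) (Of : forall z, O (f z)).

(** The residue field $O/M$, kept as a pair inside [E]; repeating [M] at every level makes it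
    discrete. *)
Definition residue_filtered : filtered k.
Proof.
apply: (@Filtered k E (f \o io) O (fun _ => M)) => //.
- by move=> c; apply: Of.
- exact: (valD vOM).
- exact: valM vOM.
- by move=> _; apply: (val_max0 vOM).
- by move=> _; apply: (val_maxD vOM).
- by move=> _; apply: (val_maxM vOM).
Defined.

End ResidueFiltered.

(** All that is retained of a residue field: the filtration is constant and its quotient is a
    domain. *)
Definition residual (F : filtered k) :=
  [/\ forall i x, fil F 0 x -> fil F i x, ~ fil F 0 1 &
      forall x y, ord F x -> ord F y -> fil F 0 (x * y) -> fil F 0 x \/ fil F 0 y].

Lemma residual_residue (E : fieldType) (f : {rmorphism A -> E}) O M (vOM : valuation_pair O M)
  (Of : forall z, O (f z)) : residual (residue_filtered vOM Of).
Proof. by split=> //; [apply: (val_max1 vOM)|apply: (val_max_prime vOM)]. Qed.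

Hypotheses (noethA : is_noetherian A) (domA : is_domain_ring A) (m1 : ~ m 1).
Hypothesis complA : is_complete_wrt m.
Variable G : filtered k.

Implicit Type x y : nat -> nat -> seq (adic * G).

(* [b] is the value of [x] at the continuous linear form [g], as a limit in [A]. *)
Definition values x (b : A) := exists j g, @form k G j g /\
  forall i, ideal_pow m i (b - contraction io g (x i j)).

Lemma contraction_compat x i j g : @family k adic G x -> @form k G j g ->
  ideal_pow m i (contraction io g (x i.+1 j) - contraction io g (x i j)) /\
  ideal_pow m i (contraction io g (x i j.+1) - contraction io g (x i j)).
Proof.
move=> [_ xc] gP.
have sub : subspace io (ideal_pow m i) by apply: (@subspace_fil k adic i).
split; apply: (not_subspaceP sub) => f lf f0;
  by rewrite (linear_formB lf) -!pairing_contraction //;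
     have [e1 e2] := xc i j f g (conj lf f0) gP; rewrite ?e1 ?e2 subrr.
Qed.

Lemma value_exists x j g : @family k adic G x -> @form k G j g ->
  exists b, forall i, ideal_pow m i (b - contraction io g (x i j)).
Proof.
move=> fx gP; apply: complA.2 => i.
by have [] := contraction_compat i fx gP.
Qed.

(** If $f \otimes g$ detects [x] at level $(i,j)$, then [f] vanishes on $m^i$ and so does not kill
    the limit of the contractions by [g]. *)
Lemma value_neq0 x : @family k adic G x -> ~ (forall i j, null i j (x i j)) ->
  exists b, values x b /\ b != 0.
Proof.
move=> fx /existsNP[i /existsNP[j /existsNP[f /existsNP[g]]]].
move=> /not_implyP[fP /not_implyP[gP]].
rewrite (pairing_contraction _ _ fP.1) => fg.
have [b bP] := value_exists fx gP; exists b; split; first by exists j, g.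
apply/eqP => b0; apply: fg; rewrite fP.2 //.
have := idealN (ideal_pow_ideal i ideal_m) (bP i).
by rewrite b0 sub0r opprK.
Qed.

Section Residue.
Variables (E : fieldType) (f : {rmorphism A -> E}) (O M : E -> Prop).
Hypotheses (vOM : valuation_pair O M) (Of : forall z, O (f z)).
Variable N : nat.

Let Ef := residue_filtered vOM Of.

Let rescale (a : A) (s : seq (A * G)) : seq (Ef * G) :=
  [seq (f p.1 / f a, p.2) | p <- s].

Let linear_form_rescale (h : E -> k) u : linear_form (f \o io) h ->
  linear_form io (fun z => h (f z * u)).
Proof.
move=> lh; split=> [z w|c z]; first by rewrite rmorphD mulrDl lh.1.
by rewrite rmorphM -mulrA -lh.2.
Qed.

(* Dividing [x N j], put in normal form, by an element [a] of minimal value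
   gives the leading form of [x] with respect to the valuation. *)
Lemma leading_form x a : f a != 0 -> @family k adic G x -> values x a ->
  (forall b, values x b -> O (f b / f a)) ->
  (forall z, ideal_pow m N z -> M (f z / f a)) ->
  exists t : nat -> seq (A * G),
  [/\ @family k Ef G (fun _ j => rescale a (t j)),
      ~ (forall i j, @null k Ef G i j (rescale a (t j))),
      forall j p, p \in t j -> ord G p.2 &
      forall j (h : A -> G -> k), balanced io (emb G) h ->
        (forall b c, fil G j c -> h b c = 0) ->
        \sum_(p <- x N j) h p.1 p.2 = \sum_(p <- t j) h p.1 p.2].
Proof.
move=> fa0 fx [j0 [g0 [g0P g0a]]] amin aN.
have [t tP] := choice (fun j => normal_form io (x N j) (subspace_fil G j)).
have tG j p : p \in t j -> ord G p.2.
  have [_ tO _] := tP j; apply: tO; first exact: subspace_ord.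
  by move=> q /(fx.1 N j q)[].
(* A contraction of row [N] differs from the value it approximates by an element of $m^N$, which is
   negligible next to [a]. *)
have contrO j g : @form k G j g -> O (f (contraction io g (x N j)) / f a).
  move=> gP; have [b bP] := value_exists fx gP.
  have Ob : O (f b / f a) by apply: amin; exists j, g.
  have := aN _ (idealN (ideal_pow_ideal N ideal_m) (bP N)) => /(val_max_sub vOM) Oz.
  have := valD vOM Ob Oz; congr O; rewrite -mulrDl -rmorphD; congr (f _ / _); ring.
have pairE j h g : linear_form (f \o io) h -> @form k G j g ->
    pairing h g (rescale a (t j)) = h (f (contraction io g (x N j)) / f a).
  move=> lh [lg g0']; have lh' := linear_form_rescale (f a)^-1 lh.
  rewrite /pairing big_map -(pairing_contraction g _ lh').
  have [_ _ tb] := tP j; rewrite /pairing.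
  rewrite (tb _ _ (balanced_pairing lh' lg)) // => b c Jc.
  by rewrite (g0' _ Jc) mulr0.
exists t; split=> //.
- split=> [_ j p /mapP[q qt ->] /=|i j h g [lh hM] gP].
    split; last exact: tG qt.
    by have [/(_ _ qt)[g [lg g0' ->]] _ _] := tP j; apply: contrO.
  split=> //; have gP' := form_le (leqnSn j) gP.
  rewrite !pairE //; apply/eqP; rewrite -subr_eq0 -(linear_formB lh) -mulrBl -rmorphB.
  rewrite (hM _ (aN _ _)) //.
  by have [] := contraction_compat N fx gP.
(* The form [g0] attaining [a] turns the leading form into 1 modulo [M], and [h] sends 1 to 1. *)
- move=> null0; have sM := subspace_fil Ef 0.
  have [h [lh hM h1]] := separating_form sM (val_max1 vOM).
  have := null0 0%N j0 h g0 (conj lh hM) g0P; rewrite pairE //.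
  have -> : f (contraction io g0 (x N j0)) / f a =
      1 - f (a - contraction io g0 (x N j0)) / f a.
    by rewrite rmorphB mulrBl divff // subKr.
  rewrite (linear_formB lh) h1 hM ?subr0; last by apply: aN; apply: g0a.
  by move/eqP; rewrite oner_eq0.
- by move=> j h bh h0; have [_ _ tb] := tP j; apply: tb.
Qed.

(** A form [h] on the residue field pulls back to $z \mapsto h(z/(ab))$ on [A], which kills $m^N$;
    the vanishing of the product at level $(N,j)$ can therefore be tested against it. *)
Lemma leading_form_mul x y a b s t j h g : f a != 0 -> f b != 0 ->
  (forall z, ideal_pow m N z -> M (f z / (f a * f b))) ->
  @family k adic G x -> @family k adic G y ->
  (forall p, p \in s -> ord G p.2) ->
  (forall h : A -> G -> k, balanced io (emb G) h -> (forall b c, fil G j c -> h b c = 0) ->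
        \sum_(p <- x N j) h p.1 p.2 = \sum_(p <- s) h p.1 p.2) ->
  (forall h : A -> G -> k, balanced io (emb G) h -> (forall b c, fil G j c -> h b c = 0) ->
        \sum_(p <- y N j) h p.1 p.2 = \sum_(p <- t) h p.1 p.2) ->
  @null k adic G N j (smul (x N j) (y N j)) ->
  @form k Ef 0 h -> @form k G j g ->
  pairing h g (smul (rescale a s) (rescale b t)) = 0.
Proof.
move=> fa0 fb0 abN fx fy sO xs yt xy0 [lh hM] [lg g0].
have lh' := linear_form_rescale (f a * f b)^-1 lh.
have hN : @form k adic N (fun z => h (f z * (f a * f b)^-1)).
  by split=> // z mz; apply: hM; apply: abN.
rewrite -[RHS](xy0 _ _ hN (conj lg g0)) /pairing.
rewrite (big_smul_congr (J := fil G j) (O := ord G) (t := s) (t' := t)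
   (balanced_pairing lh' lg)) //.
- rewrite (big_smul (fun a b => h a * g b)) (big_smul (fun z w => h (f z * _) * g w)).
  rewrite big_map; apply: eq_bigr => p _; rewrite big_map; apply: eq_bigr => q _ /=.
  by congr (h _ * _); rewrite rmorphM invfM mulrACA.
- by move=> z w Jw; rewrite (g0 _ Jw) mulr0.
- by move=> r z; apply: filM.
- by move=> p /(fy.1 N j p)[].
Qed.

End Residue.

Theorem adic_tensor_domain (E : fieldType) (f : {rmorphism A -> E}) : injective f ->
  (forall F, residual F -> tensor_domain F G) -> tensor_domain adic G.
Proof.
move=> f_inj H x y fx fy xy0; apply: contrapT => /not_orP[nx ny].
have [a1 [va1 a1n0]] := value_neq0 fx nx; have [b1 [vb1 b1n0]] := value_neq0 fy ny.
have ab0 : a1 * b1 != 0.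
  by apply/eqP => /domA.2[/eqP|/eqP]; apply/negP.
(* Least values make sense only once a valuation is given, so it is chosen for arbitrary nonzero
   values [a1] and [b1]. Passing to [a] and [b] of least value can only lower $v(ab)$, and the bound
   against $m^N$ persists. *)
have [N [O [M [vOM Of qM]]]] := dominating_valuation noethA domA ideal_m m1 f_inj ab0.
have [a [va an0 amin]] := minimal_value noethA f_inj vOM Of va1 a1n0.
have [b [vb bn0 bmin]] := minimal_value noethA f_inj vOM Of vb1 b1n0.
have f0 z : z != 0 -> f z != 0 by rewrite (rmorph_inj_eq0 f_inj).
have abN z : ideal_pow m N z -> M (f z / (f a * f b)).
  move=> /qM Mz; have := val_maxM vOM (valM vOM (amin _ va1) (bmin _ vb1)) Mz.
  congr M; rewrite rmorphM; field; rewrite ?f0 //.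
have aN z : ideal_pow m N z -> M (f z / f a).
  move=> /abN Mz; have := val_maxM vOM (Of b) Mz; congr M; field; rewrite ?f0 //.
have bN z : ideal_pow m N z -> M (f z / f b).
  move=> /abN Mz; have := val_maxM vOM (Of a) Mz; congr M; field; rewrite ?f0 //.
have [s [fs ns sO xs]] := leading_form vOM Of (f0 _ an0) fx va amin aN.
have [t [ft nt tO yt]] := leading_form vOM Of (f0 _ bn0) fy vb bmin bN.
have [||] // := H _ (residual_residue vOM Of) _ _ fs ft.
move=> i j h g hP gP.
exact: (leading_form_mul (f0 _ an0) (f0 _ bn0) abN fx fy (sO j) (xs j) (yt j)) hP gP.
Qed.

End AdicReduction.

(** * Specialisation to an algebraically closed field *)

Definition prime_ideal (R : comNzRingType) (p : R -> Prop) :=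
  [/\ is_ideal p, ~ p 1 & forall x y, p (x * y) -> p x \/ p y].

(** Density of the [k]-points of $D/p$. The quotient is not formed, so that [D] can remain a
    polynomial ring. *)
Definition has_points (k : closedFieldType) (D : idomainType) (io : {rmorphism k -> D})
    (p : D -> Prop) :=
  forall g, ~ p g -> exists h : {rmorphism D -> k},
    [/\ forall c, h (io c) = c, forall x, p x -> h x = 0 & h g != 0].

Lemma prime_idealX (R : comNzRingType) (p : R -> Prop) x n :
  prime_ideal p -> p (x ^+ n) -> p x.
Proof.
case=> _ p1 pM; elim: n => [|n IH]; first by rewrite expr0.
by rewrite exprS => /pM[].
Qed.

Lemma min_size (R : nzRingType) (T : {poly R} -> Prop) F : T F ->
  exists F, T F /\ forall F', T F' -> (size F <= size F')%N.
Proof.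
move=> TF; have ex : exists n, `[< exists F, T F /\ size F = n >].
  by exists (size F); apply/asboolP; exists F.
case: (ex_minnP ex) => n /asboolP[F0 [TF0 sF0]] nmin; exists F0; split=> // F' TF'.
by rewrite sF0; apply: nmin; apply/asboolP; exists F'.
Qed.

Section PointsOfPolynomials.
Variables (k : closedFieldType) (D : idomainType) (io : {rmorphism k -> D}).
Variables (p : D -> Prop) (P : {poly D} -> Prop).
Hypotheses (prime_p : prime_ideal p) (prime_P : prime_ideal P).
Hypothesis Pp : forall c, P c%:P <-> p c.

Let cz (F : {poly D}) := forall i, p F`_i.

Let czP F : cz F -> P F.
Proof.
move=> cF; have [iP _ _] := prime_P; have [_ _ PM] := iP.
rewrite -[F]coefK poly_def; apply: ideal_sum => // i _.
by rewrite -mul_polyC mulrC; apply: PM; apply/Pp.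
Qed.

(** Dropping leading terms with coefficient in [p] makes the size of a polynomial reflect its degree
    over $D/p$. *)
Let truncation F : ~ cz F ->
  exists F', [/\ ~ p (lead_coef F'), (size F' <= size F)%N & cz (F - F')].
Proof.
have [[p0 _ _] _ _] := prime_p.
have [n] := ubnP (size F); elim: n => // n IH in F *; move=> sF nF.
have [pl|npl] := pselect (p (lead_coef F)); last first.
  by exists F; split=> // i; rewrite subrr coef0.
pose l := lead_coef F *: 'X^((size F).-1).
have cl : cz l.
  move=> i; rewrite coefZ coefXn; case: eqP => _; rewrite ?mulr1 ?mulr0 //.
have F0 : F != 0 by apply/eqP => F0; apply: nF => i; rewrite F0 coef0.
have sFl : (size (F - l)%R < size F)%N.
  rewrite -[X in (_ < X)%N]prednK ?size_poly_gt0 // ltnS.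
  apply/leq_sizeP => i; rewrite leq_eqVlt => /orP[/eqP <-|li].
    by rewrite coefB coefZ coefXn eqxx mulr1 subrr.
  rewrite coefB coefZ coefXn gtn_eqF // mulr0 subr0 nth_default //.
  by rewrite -[size F]prednK ?size_poly_gt0.
have [ip _ _] := prime_p; have [_ pD _] := ip.
have [||F' [nF' sF' cF']] := IH (F - l).
- by apply: leq_trans sFl _; rewrite -ltnS.
- move=> cFl; apply: nF => i; rewrite -[F](subrK l) coefD; exact: pD.
- exists F'; split=> //; first exact: leq_trans (ltnW sFl).
  by move=> i; rewrite -[F](subrK l) addrAC coefD; apply: pD.
Qed.

Let cz_map (h : {rmorphism D -> k}) F : (forall x, p x -> h x = 0) -> cz F ->
  map_poly h F = 0.
Proof. by move=> hp cF; apply/polyP => i; rewrite coef_map coef0 /= hp. Qed.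

Let evaluation (h : {rmorphism D -> k}) (c : k) : exists h' : {rmorphism {poly D} -> k},
  forall F, h' F = (map_poly h F).[c].
Proof.
have cfu : commr_rmorph h c by move=> y; apply: mulrC.
by exists (horner_morph cfu).
Qed.

(** If $P = p[X]$, a coefficient of [g] is kept nonzero and the roots are avoided. Otherwise [X] is
    algebraic over the fractions of $D/p$, with minimal polynomial [f] up to denominators, and [g]
    becomes invertible: some multiple of it is, modulo [P], a constant [G] outside [p]. *)
Lemma has_points_poly : has_points io p -> has_points (polyC \o io) P.
Proof.
move=> good g nPg; have [iP P1 PM] := prime_P; have [P0 PD PZ] := iP.
have [ip p1 pM] := prime_p; have [p0 pD pZ] := ip.
have ncg : ~ cz g by move/czP.
have [Pcz|nPcz] := pselect (forall F, P F -> cz F).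
  have /existsNP[i ngi] := ncg; have [h [hio hp hg]] := good _ ngi.
  have /closed_nonrootP[c rc] : map_poly h g != 0.
    by apply/eqP => /polyP/(_ i); rewrite coef_map coef0; apply/eqP.
  have [h' h'E] := evaluation h c; exists h'; split.
  - by move=> d; rewrite h'E /= map_polyC hornerC; apply: hio.
  - by move=> F /Pcz cF; rewrite h'E (cz_map hp cF) horner0.
  - by rewrite h'E.
have trP F : P F -> ~ cz F -> exists F', [/\ P F', ~ p (lead_coef F') & (size F' <= size F)%N].
  move=> PF /truncation[F' [lF' sF' cF']]; exists F'; split=> //.
  by rewrite -[F'](subKr F); apply: idealB => //; apply: czP.
have [f [[Pf lf] fmin]] : exists f, (P f /\ ~ p (lead_coef f)) /\
    forall F, P F /\ ~ p (lead_coef F) -> (size f <= size F)%N.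
  have /existsNP[F /not_implyP[PF ncF]] := nPcz.
  have [F' [PF' lF' _]] := trP _ PF ncF.
  exact: (@min_size _ (fun F => P F /\ ~ p (lead_coef F)) F').
pose T G := ~ p (lead_coef G) /\ exists v, P (G - v * g).
have [G [[lG [v Pv]] Gmin]] : exists G, T G /\ forall F, T F -> (size G <= size F)%N.
  have [g' [lg' _ cg']] := truncation ncg; apply: (@min_size _ T g'); split=> //.
  exists 1; rewrite mul1r -opprB; apply: idealN => //; exact: czP.
have fcz F : P F -> (size F < size f)%N -> cz F.
  move=> PF sF; apply: contrapT => /(trP _ PF)[F' [PF' lF' sF']].
  by have := leq_trans (fmin _ (conj PF' lF')) sF'; rewrite leqNgt sF.
have Gcz F w : P (F - w * g) -> (size F < size G)%N -> cz F.
  move=> PF sF; apply: contrapT => /truncation[F' [lF' sF' cF']].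
  have TF' : T F'.
    split=> //; exists w; rewrite -[F'](subKr F) addrAC; apply: idealB => //.
    exact: czP.
  by have := leq_trans (Gmin _ TF') sF'; rewrite leqNgt sF.
have lcn0 F : ~ p (lead_coef F) -> F != 0.
  by move=> lF; apply/eqP => F0; apply: lF; rewrite F0 lead_coef0.
have G0 := lcn0 _ lG; have f0 := lcn0 _ lf.
have sGf : (size G <= size f)%N by apply: Gmin; split=> //; exists 0; rewrite mul0r subr0.
(* Euclid's argument: the pseudo-remainder of [f] by [G] is again a multiple of [g] modulo [P],
   hence zero over $D/p$ by minimality. So $wG \in P$ for the quotient [w], and $w \in P$ is
   excluded by degree. *)
have sG1 : size G = 1%N.
  apply/eqP; rewrite eqn_leq [(0 < _)%N]size_poly_gt0 G0 andbT leqNgt; apply/negP => sG.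
  have := Pdiv.Idomain.divp_eq f G; set w := (f %/ G)%R; set r := (f %% G)%R => fE.
  have sr : (size r < size G)%N by rewrite Pdiv.Idomain.ltn_modp.
  have rE : r = lead_coef G ^+ scalp f G *: f - w * G by rewrite fE addrC addKr.
  have Pr : P r.
    apply/czP/(Gcz r (- w * v)) => //; rewrite rE -mul_polyC.
    have -> : (lead_coef G ^+ scalp f G)%:P * f - w * G - (- w * v) * g =
       (lead_coef G ^+ scalp f G)%:P * f - w * (G - v * g) by ring.
    by apply: idealB => //; apply: PZ.
  have : P (w * G).
    have -> : w * G = (lead_coef G ^+ scalp f G)%:P * f - r by rewrite rE -mul_polyC; ring.
    by apply: idealB => //; apply: PZ.
  move=> /PM[Pw|PG].
    have wG : w * G = lead_coef G ^+ scalp f G *: f - r by rewrite rE; ring.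
    have lc0 : lead_coef G ^+ scalp f G != 0 by rewrite expf_neq0 // lead_coef_eq0.
    have sr' : (size (- r)%R < size (lead_coef G ^+ scalp f G *: f)%R)%N.
      by rewrite size_polyN size_scale // (leq_trans sr).
    have swG : size (w * G)%R = size f by rewrite wG size_polyDl // size_scale.
    have w0 : w != 0.
      by apply/eqP => w0; move: swG f0; rewrite w0 mul0r size_poly0 -size_poly_eq0 => <-.
    have cw : cz w.
      apply: fcz => //; move: swG; rewrite size_mul //; lia.
    have : p (lead_coef (w * G)).
      by rewrite lead_coefM mulrC; apply: pZ; rewrite lead_coefE; apply: cw.
    rewrite wG lead_coefDl // lead_coefZ => /pM[|//].
    by move/(prime_idealX prime_p).
  (* There remains $G \in P$: dividing [g] by [G] then puts [g] itself in [P]. *)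
  have sfG : size f = size G by apply/eqP; rewrite eqn_leq sGf andbT; apply: fmin.
  have := Pdiv.Idomain.divp_eq g G; set w' := (g %/ G)%R; set r' := (g %% G)%R => gE.
  have sr' : (size r' < size G)%N by rewrite Pdiv.Idomain.ltn_modp.
  have rE' : r' = (lead_coef G ^+ scalp g G)%:P * g - w' * G.
    by rewrite mul_polyC gE addrC addKr.
  have Pr' : P r'.
    apply/czP/(Gcz r' (lead_coef G ^+ scalp g G)%:P) => //.
    rewrite rE' addrAC subrr add0r; apply: idealN => //; exact: PZ.
  have : P ((lead_coef G ^+ scalp g G)%:P * g).
    by rewrite mul_polyC gE; apply: PD => //; apply: PZ.
  by move=> /PM[/Pp/(prime_idealX prime_p)|].
have sf2 : size f != 1%N.
  apply/eqP => sf1; apply: lf; apply/Pp.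
  by rewrite lead_coefE sf1 -[(f`_0)%:P]size1_polyC ?sf1.
(* Keeping the leading coefficient of [f] nonzero preserves its degree, so its specialisation has a
   root; keeping that of [G] nonzero prevents [g] from vanishing. *)
have npl : ~ p (lead_coef G * lead_coef f) by move=> /pM[].
have [h [hio hp]] := good _ npl; rewrite rmorphM mulf_eq0 negb_or => /andP[hG hf].
have /closed_rootP[c rc] : size (map_poly h f) != 1%N.
  by rewrite size_map_poly_id0.
have [h' h'E] := evaluation h c; have h'f : h' f = 0 by rewrite h'E; apply/eqP.
have h'C d : h' d%:P = h d by rewrite h'E map_polyC hornerC.
have h'P F : P F -> h' F = 0.
  move=> PF; have := Pdiv.Idomain.divp_eq F f; set w := (F %/ f)%R; set r := (F %% f)%R => FE.
  have cr : cz r.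
    apply: fcz; last by rewrite Pdiv.Idomain.ltn_modp.
    have -> : r = (lead_coef f ^+ scalp F f)%:P * F - w * f.
      by rewrite mul_polyC FE addrC addKr.
    by apply: idealB => //; apply: PZ.
  move: (congr1 h' FE); rewrite -mul_polyC rmorphD !rmorphM h'f mulr0 add0r.
  rewrite [h' r]h'E (cz_map hp cr) horner0 h'C rmorphXn => /eqP.
  by rewrite mulf_eq0 expf_eq0 (negPf hf) andbF => /eqP.
exists h'; split=> //; first by move=> d; rewrite h'C; apply: hio.
apply/eqP => h'g; move: (h'P _ Pv); rewrite rmorphB rmorphM h'g mulr0 subr0.
have -> : G = (lead_coef G)%:P by rewrite lead_coefE sG1 [LHS]size1_polyC ?sG1.
by rewrite h'C; apply/eqP.
Qed.

End PointsOfPolynomials.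

(** * Tensor products of domains over an algebraically closed field *)

Section ResidualTensor.
Variable k : closedFieldType.

(** The algebra generated by [rs] is the image of a polynomial ring with one variable per element,
    so points extend one variable at a time from [k], where the identity is a point. *)
Lemma residual_points (F : filtered k) (rs : seq F) : residual F ->
  (forall r, r \in rs -> ord F r) ->
  exists (D : idomainType) (io : {rmorphism k -> D}) (e : {rmorphism D -> F}),
  [/\ forall c, e (io c) = emb F c, forall d, ord F (e d),
      has_points io (fun d => fil F 0 (e d)) &
      forall r, r \in rs -> exists d, e d = r].
Proof.
move=> [_ M1 Mp]; elim: rs => [|r rs IH] rsO.
  exists k, idfun, (emb F); split=> //; first exact: ord_emb.
  move=> g ng; exists idfun; split=> //= [x|].
    have [//|x0 Mx] := eqVneq x 0; case: M1.
    by rewrite -(rmorph1 (emb F)) -(mulVf x0) rmorphM; apply: filM => //; apply: ord_emb.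
  by apply/eqP => g0; apply: ng; rewrite g0 rmorph0; apply: fil0.
have [|D [io [e [eio eO eP eR]]]] := IH.
  by move=> x xs; apply: rsO; rewrite inE xs orbT.
have cfu : commr_rmorph e r by move=> y; apply: mulrC.
have prime (D' : comNzRingType) (e' : {rmorphism D' -> F}) : (forall d, ord F (e' d)) ->
    prime_ideal (fun d => fil F 0 (e' d)).
  move=> eO'; split; [split| |].
  - by rewrite rmorph0; apply: fil0.
  - by move=> x y; rewrite rmorphD; apply: filD.
  - by move=> x y; rewrite rmorphM; apply: filM.
  - by rewrite rmorph1.
  - by move=> x y; rewrite rmorphM; apply: Mp.
have e'O P : ord F (horner_morph cfu P).
  change (ord F (map_poly e P).[r]); rewrite horner_coef.
  have [O0 OD _] := subspace_ord F; apply: (big_ind (ord F)) => // i _.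
  rewrite coef_map /=; apply: ordM => //; elim: (i : nat) => [|n IHn].
    by rewrite expr0 -(rmorph1 (emb F)); apply: ord_emb.
  by rewrite exprS; apply: ordM => //; apply: rsO; rewrite mem_head.
exists {poly D}, (polyC \o io), (horner_morph cfu); split=> //.
- by move=> c; rewrite [LHS]horner_morphC eio.
- apply: (has_points_poly _ _ _ eP); [exact: prime|exact: prime|].
  by move=> c; change (fil F 0 (horner_morph cfu c%:P) <-> fil F 0 (e c)); rewrite horner_morphC.
- move=> x; rewrite inE => /orP[/eqP->|/eR[d dx]].
    by exists 'X; rewrite [LHS]horner_morphX.
  by exists d%:P; rewrite [LHS]horner_morphC.
Qed.

Lemma form_residual (F : filtered k) i j (f : F -> k) : residual F ->
  @form k F i f -> @form k F j f.
Proof.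
move=> [cF _ _] [lf f0]; split=> // x /(fil_le (leq0n j)) Mx.
by apply: f0; apply: cF.
Qed.

(** Contractions of [s] and [t] that are nonzero modulo [fil F 0] lift to [D], and a point [h] keeps
    both nonzero. Applying [h] to first components sends [s] and [t] to elements of [G] whose
    product is zero modulo [fil G 0], which is prime. *)
Lemma residual_smul (F G : filtered k) (s t : seq (F * G)) : residual F -> residual G ->
  (forall p, p \in s -> ord F p.1 /\ ord G p.2) ->
  (forall p, p \in t -> ord F p.1 /\ ord G p.2) ->
  null 0 0 (smul s t) -> null 0 0 s \/ null 0 0 t.
Proof.
move=> rF rG sO tO st0; apply: contrapT => /not_orP[].
move=> /existsNP[f1 /existsNP[g1 /not_implyP[f1P /not_implyP[g1P]]]].
rewrite (pairing_contraction _ _ f1P.1) => n1.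
move=> /existsNP[f2 /existsNP[g2 /not_implyP[f2P /not_implyP[g2P]]]].
rewrite (pairing_contraction _ _ f2P.1) => n2.
have [r|D [io [e [eio eO eP eR]]]] :=
    @residual_points F ([seq p.1 | p <- s] ++ [seq p.1 | p <- t]) rF.
  by rewrite mem_cat => /orP[] /mapP[p ps ->]; [have [] := sO p ps|have [] := tO p ps].
have [d dP] : exists d : F -> D, forall p, p \in s \/ p \in t -> e (d p.1) = p.1.
  have /choice[d dP] : forall r, exists x,
      r \in [seq p.1 | p <- s] ++ [seq p.1 | p <- t] -> e x = r.
    by move=> r; case: (boolP (r \in _)) => [/eR[x ex]|_]; [exists x|exists 0].
  by exists d => p ps; apply: dP; rewrite mem_cat; case: ps => ps; rewrite (map_f fst ps) ?orbT.
pose lift (u : seq (F * G)) g := \sum_(p <- u) io (g p.2) * d p.1.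
have liftE (u : seq (F * G)) g : (forall p, p \in u -> p \in s \/ p \in t) ->
    e (lift u g) = contraction (emb F) g u.
  move=> us; rewrite rmorph_sum; apply: eq_big_seq => p pu.
  by rewrite rmorphM eio dP //; apply: us.
have [_ M1 Mp] := rF.
have nMlift : ~ fil F 0 (e (lift s g1 * lift t g2)).
  rewrite rmorphM => /(Mp _ _ (eO _) (eO _)) []; rewrite liftE => [Mu|p pu].
  - by apply: n1; apply: f1P.2.
  - by left.
  - by apply: n2; apply: f2P.2.
  - by right.
have [h [hio hM]] := eP _ nMlift; rewrite rmorphM mulf_eq0 negb_or => /andP[hs ht].
pose U (u : seq (F * G)) := \sum_(p <- u) emb G (h (d p.1)) * p.2.
have gU (u : seq (F * G)) g : @form k G 0 g -> g (U u) = h (lift u g).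
  move=> [lg _]; rewrite (linear_form_sum lg) rmorph_sum; apply: eq_bigr => p _.
  by rewrite lg.2 rmorphM hio mulrC.
have UO u : (forall p, p \in u -> ord F p.1 /\ ord G p.2) -> ord G (U u).
  move=> uO; apply: (subspace_sum (subspace_ord G)) => p /uO[_ Op].
  by apply: ordM => //; apply: ord_emb.
have MU : fil G 0 (U s * U t).
  apply: (not_subspaceP (subspace_fil G 0)) => g lg g0.
  (* [h] lives on [D], whereas nullity is tested by forms on [F]. A dual family of the products of
     first components yields a form [f] on all of [F] that agrees with [h] on these products. *)
  have [n [fs [es [fsP esP Lsp]]]] :=
    dual_family [seq p.1 * q.1 | p <- s, q <- t] (subspace_fil F 0).
  (* The [es l] lie in the span of the products, hence in the image of [e]. *)
  have /choice[x xP] : forall l, exists a, e a = es l.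
    move=> l; apply: (esP (fun y => exists a, e a = y)).
      split; first by exists 0; rewrite rmorph0.
        by move=> _ _ [a <-] [b <-]; exists (a + b); rewrite rmorphD.
      by move=> c _ [a <-]; exists (io c * a); rewrite rmorphM eio.
    move=> b /allpairsP[[p q] [ps qt ->]]; exists (d p.1 * d q.1).
    by rewrite rmorphM !dP; [|right|left].
  pose f b := \sum_(l < n) h (x l) * fs l b.
  have fP : @form k F 0 f.
    split; first split.
    - move=> a b; rewrite -big_split; apply: eq_bigr => l _.
      by rewrite (fsP l).1.1 mulrDr.
    - move=> c b; rewrite mulr_sumr; apply: eq_bigr => l _.
      by rewrite (fsP l).1.2 mulrCA.
    - by move=> b Mb; apply: big1 => l _; rewrite (fsP l).2 // mulr0.
  have hf p q : p \in s -> q \in t -> h (d p.1) * h (d q.1) = f (p.1 * q.1).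
    move=> ps qt; have pq : p.1 * q.1 \in [seq p.1 * q.1 | p <- s, q <- t].
      by apply/allpairsP; exists (p, q).
    have := Lsp _ pq; set b := p.1 * q.1.
    have -> : b - \sum_(l < n) emb F (fs l b) * es l =
        e (d p.1 * d q.1 - \sum_(l < n) io (fs l b) * x l).
      rewrite rmorphB rmorphM !dP; [|by right|by left]; congr (_ - _).
      by rewrite rmorph_sum; apply: eq_bigr => l _; rewrite rmorphM eio xP.
    move=> /hM/eqP; rewrite rmorphB rmorphM subr_eq0 => /eqP ->.
    by rewrite rmorph_sum; apply: eq_bigr => l _; rewrite rmorphM hio mulrC.
  have := st0 f g fP (conj lg g0); rewrite /pairing (big_smul (fun a b => f a * g b)) => <-.
  rewrite mulr_suml (linear_form_sum lg); apply: eq_big_seq => p ps.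
  rewrite mulr_sumr (linear_form_sum lg); apply: eq_big_seq => q qt.
  by rewrite -hf // mulrACA -(rmorphM (emb G)) lg.2.
have [_ _ Mp'] := rG.
have [Ms|Mt] := Mp' _ _ (UO _ sO) (UO _ tO) MU.
  by move: hs; rewrite -(gU _ _ g1P) g1P.2 // eqxx.
by move: ht; rewrite -(gU _ _ g2P) g2P.2 // eqxx.
Qed.

Theorem residual_tensor_domain (F G : filtered k) :
  residual F -> residual G -> tensor_domain F G.
Proof.
move=> rF rG x y fx fy xy0.
have const z i j f g : @family k F G z -> @form k F 0 f -> @form k G 0 g ->
    pairing f g (z i j) = pairing f g (z 0%N 0%N).
  move=> [_ zc] fP gP; elim: i => [|i IH]; last first.
    by rewrite -IH; have [] := zc i j f g (form_residual _ rF fP) (form_residual _ rG gP).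
  elim: j => // j IH.
  by rewrite -IH; have [] := zc 0%N j f g fP (form_residual _ rG gP).
have all0 z : @family k F G z -> null 0 0 (z 0%N 0%N) -> forall i j, null i j (z i j).
  move=> fz z0 i j f g fP gP; have f0 := form_residual 0 rF fP.
  have g0 := form_residual 0 rG gP; rewrite const //; exact: z0.
have [||x0|y0] := residual_smul rF rG _ _ (xy0 0%N 0%N).
- exact: fx.1.
- exact: fy.1.
- by left; apply: all0.
- by right; apply: all0.
Qed.

End ResidualTensor.

(** * The completed tensor product as a limit of tensor products *)

Lemma fraction_embedding (A : comUnitRingType) : is_domain_ring A ->
  exists (E : fieldType) (f : {rmorphism A -> E}), injective f.
Proof.
move=> [_ domA].
have ax (x y : A) : x * y = 0 -> (x == 0) || (y == 0).
  by move=> /domA[]->; rewrite eqxx ?orbT.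
pose D : idomainType := HB.pack_for idomainType A (GRing.ComUnitRing_isIntegral.Build A ax).
exists {fraction D}, (GRing.RMorphism.clone D {fraction D} (@tofrac D) _).
move=> x y /eqP exy; apply/eqP; rewrite -subr_eq0.
by rewrite -(@tofrac_eq0 D (x - y)) rmorphB subr_eq0.
Qed.

Lemma max_ideal_ideal (A : comUnitRingType) : is_local A -> is_ideal (@max_ideal A).
Proof.
move=> [_ addA]; split=> //; first by rewrite /max_ideal unitr0.
by move=> r x; rewrite /max_ideal unitrM negb_and => ->; rewrite orbT.
Qed.

Lemma max_ideal1 (A : comUnitRingType) : ~ @max_ideal A 1.
Proof. by rewrite /max_ideal unitr1. Qed.

Section Comparison.
Variables (k : fieldType) (A B : comUnitAlgType k) (I : A -> Prop) (J : B -> Prop).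
Hypotheses (sI : subspace (in_alg A) I) (sJ : subspace (in_alg B) J).

Lemma tens_eq_pairing s t f g : tens_eq I J s t ->
  linear_form (in_alg A) f -> vanishes_on I f ->
  linear_form (in_alg B) g -> vanishes_on J g -> pairing f g s = pairing f g t.
Proof.
move=> st lf f0 lg g0.
apply: (st k^o (fun a b => f a * g b)) => [|a b /f0 ->|a b /g0 ->]; rewrite ?mul0r ?mulr0 //.
split=> [c a a' b|c a b b'].
  by rewrite lf.1 -mulr_algl lf.2 mulrDl -mulrA.
by rewrite lg.1 -mulr_algl lg.2 mulrDr mulrCA.
Qed.

(** In normal form the first components are contractions of [s]; every form vanishing on [I] kills
    them, so they lie in [I] and each term is zero separately. *)
Lemma tens_eq0 s :
  (forall f g, linear_form (in_alg A) f -> vanishes_on I f ->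
     linear_form (in_alg B) g -> vanishes_on J g -> pairing f g s = 0) ->
  tens_eq I J s [::].
Proof.
move=> s0 V phi [phil phir] phiI phiJ; rewrite big_nil.
have [t [tI _ ->]] := normal_form (in_alg A) s sJ.
- apply: big1_seq => p /andP[_ /tI[g [lg g0 p1]]]; apply: phiI; rewrite p1.
  by apply: (not_subspaceP sI) => f lf f0; rewrite -pairing_contraction //; apply: s0.
- have phi0 b : phi 0 b = 0.
    by have := phil (-1) 0 0 b; rewrite scaler0 add0r scaleN1r addNr.
  have phir0 a : phi a 0 = 0.
    by have := phir (-1) a 0 0; rewrite scaler0 add0r scaleN1r addNr.
  split=> [a a' b|a b b'|c a b].
  + by rewrite -[X in phi (X + _)]scale1r phil scale1r.
  + by rewrite -[X in phi _ (X + _)]scale1r phir scale1r.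
  + rewrite /= !mulr_algl -[c *: a]addr0 phil phi0 addr0.
    by rewrite -[c *: b]addr0 phir phir0 addr0.
- by move=> a b; apply: phiJ.
Qed.

End Comparison.

Theorem theorem3p9 (k : closedFieldType) (A B : comUnitAlgType k) :
  is_local A -> is_noetherian A -> is_complete_local A ->
  is_local B -> is_noetherian B -> is_complete_local B ->
  ctens_noetherian A B ->
  is_domain_ring A -> is_domain_ring B ->
  ctens_domain A B.
Proof.
move=> locA noethA complA locB noethB complB _ domA domB.
have iA := max_ideal_ideal locA; have iB := max_ideal_ideal locB.
pose F := adic (in_alg A) iA; pose G := adic (in_alg B) iB.
have sF i : subspace (in_alg A) (ideal_pow (@max_ideal A) i) := subspace_fil F i.
have sG i : subspace (in_alg B) (ideal_pow (@max_ideal B) i) := subspace_fil G i.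
have FG : tensor_domain F G.
  have [E [f f_inj]] := fraction_embedding domA.
  have [E' [f' f'_inj]] := fraction_embedding domB.
  apply: (adic_tensor_domain noethA domA (@max_ideal1 A) complA f_inj) => F' rF'.
  (* With the first factor already residual, exchanging the factors lets the same reduction act on
     [B]. *)
  apply: tensor_domain_swap.
  apply: (adic_tensor_domain noethB domB (@max_ideal1 B) complB f'_inj) => G' rG'.
  exact: residual_tensor_domain.
have family_elt x : ctens_elt x -> @family k F G x.
  move=> ex; split=> // i j f g [lf f0] [lg g0]; have [e1 e2] := ex i j.
  by split; [apply: (tens_eq_pairing e1 lf f0 lg g0)|apply: (tens_eq_pairing e2 lf f0 lg g0)].
have null_eq0 x : (forall i j, @null k F G i j (x i j)) -> ctens_eq x (@ctens0 k A B).
  move=> x0 i j; apply: tens_eq0 => // f g lf f0 lg g0.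
  exact: (x0 i j f g (conj lf f0) (conj lg g0)).
split.
  (* Level 1 is the first informative one, the zeroth power of an ideal being the whole ring. *)
  move=> /(_ 1%N 1%N) e10.
  have n1 (R : comUnitRingType) : is_ideal (@max_ideal R) -> ~ ideal_pow (@max_ideal R) 1 1.
    by move=> iR /(ideal_pow1 _ iR)/max_ideal1.
  have [f [lf f0 f1]] := separating_form (sF 1%N) (n1 _ iA).
  have [g [lg g0 g1]] := separating_form (sG 1%N) (n1 _ iB).
  have := tens_eq_pairing e10 lf f0 lg g0.
  by rewrite /pairing big_seq1 big_nil f1 g1 mulr1 => /eqP; rewrite oner_eq0.
move=> x y ex ey xy0; have [||i j f g [lf f0] [lg g0]|x0|y0] := FG x y.
- exact: family_elt.
- exact: family_elt.
- rewrite (tens_eq_pairing (xy0 i j) lf f0 lg g0).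
  by rewrite /pairing big_nil.
- by left; apply: null_eq0.
- by right; apply: null_eq0.
Qed.
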